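(* In the setting of a nonstationary nonuniformly expanding dynamical system described in the context, suppose that $\mu$ is a regular probability measure on $X$ with tail bound $r$. Then for each sequence $T_1,T_2,\ldots\in\mathcal{T}$ there exists a decomposition $$\mu=\sum_{n=1}^\infty\alpha_n\mu_n,$$ where $\mu_n$ are probability measures and $\alpha_n$ are nonnegative constants with $\sum_{n\ge1}\alpha_n=1$ such that $(T_{1,n})_*\mu_n=m$ for each $n$. The sequence $(\alpha_n)$ is fully determined by $K_1$, $K_2$, the constants $\operatorname{diam}X$, $K$, $\lambda$, $n_0$, $\delta_0$ and the functions $h$ and $r$. In particular, $\alpha_n$ does not depend on $\mu$ in any other way. Moreover: (1) If $h(n)\le C_\beta n^{-\beta}$ with $\beta>1$ and $r(n)\le C'_\beta n^{-\beta'}$ with $\beta'\in(0,\beta]$ (for $n\ge1$), then for $n\ge1$ $$\sum_{j\ge n}\alpha_j\le C\,C'_\beta\, n^{-\beta'},$$ where $C$ depends only on $C_\beta,\beta,\beta',K_1,K_2,\operatorname{diam}X,K,\lambda,n_0,\delta_0$ (i.e. on everything except $C'_\beta$). (2) If $h(n)\le C_\beta n^{-\beta}$ with $\beta>1$ (for $n\ge1$), then for $n\ge 2n_0$, $$\sum_{j\ge n}\alpha_j\le r(\lfloor n/2\rfloor-n_0)+C n^{-\beta}\sum_{j=1}^\infty r(j),$$ where $C$ depends only on $C_\beta,\beta,K_1,K_2,\operatorname{diam}X,K,\lambda,n_0,\delta_0$. (3) If $h(n),r(n)\le C_\beta\exp(-C'_\beta n^\beta)$ with $\beta\in(0,1]$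 and $C_\beta,C'_\beta>0$, then $$\sum_{j\ge n}\alpha_j\le C\exp(-C'n^\beta),$$ where $C>0$ and $C'>0$ depend only on $C_\beta,C'_\beta,\beta,K_1,K_2,\operatorname{diam}X,K,\lambda,n_0,\delta_0$.
   Context: Setting. $(X,d)$ is a bounded, separable, universally measurable metric space (i.e. $X$ is measurable in its completion with respect to the completion of every Borel probability measure there), with its Borel $\sigma$-algebra; all sets considered are measurable. $Y\subset X$, and $m$ is a probability measure on $X$ with $m(Y)=1$. $\mathcal{T}$ is a class of measurable transformations $X\to X$. For a sequence $T_1,T_2,\ldots$ write $T_{k,\ell}=T_\ell\circ\cdots\circ T_k$ (identity if $k>\ell$). $(\cdot)_*$ denotes pushforward and $\mu|_a$ restriction. For a nonnegative measure $\mu$ on $Y$ with density $\rho=d\mu/dm$ let $|\mu|_{\mathrm{LL}}=\sup_{y\ne y'\in Y}\frac{|\log\rho(y)-\log\rho(y')|}{d(y,y')}$, with the convention $\log0=-\infty$ and $\log0-\log0=0$ (a bound on $|\mu|_{\mathrm{LL}}$ includes the requirement that $\mu$ has a density). For $\zeta$ a density, $|\zeta|_{\mathrm{LL}}$ means the same seminorm of $\log\zeta$. It is assumed that there are constants $\lambda>1$, $K>0$, $\delta_0>0$, $n_0\ge1$ and a function $h\colon\{0,1,\ldots\}\to[0,\infty)$ such that the following holds for each sequence $T_1,T_2,\ldots\in\mathcal{T}$. Let $\tau(x)=\inf\{n\ge1:T_{1,n}(x)\in Y\}$. There is a finite or countable partition $\mathcal{P}$ of $X$, up to an $m$-zero measure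 set, such that $Y$ is $\mathcal{P}$-measurable and for each $a\in\mathcal{P}$: (NU1) $m(a)>0$ if $a\subset Y$. (NU2) $\tau$ is constant on $a$ with value $\tau(a)$. (NU3) If $a\subset Y$, then the map $F_a=T_{1,\tau(a)}\colon a\to Y$ is a bijection, and $d(F_a(y),F_a(y'))\ge\lambda d(y,y')$ for all $y,y'\in a$; further, $F_a$ is nonsingular with log-Lipschitz Jacobian: $\zeta=\frac{d(F_a)_*(m|_a)}{dm}$ satisfies $|\zeta|_{\mathrm{LL}}\le K$. (NU4) For all $x,x'\in a$, with $F_a=T_{1,\tau(a)}$, $\max_{0\le j\le\tau(a)}d(T_{1,j}(x),T_{1,j}(x'))\le K\,d(F_a(x),F_a(x'))$. And: (NU5) $m(\tau\ge n)\le h(n)$ for all $n$. (NU6) $\sum_{n=1}^\infty h(n)\le K$. (NU7) $m(T_{1,n}^{-1}(Y))\ge\delta_0$ for every $n\ge n_0$. Constants $0<K_1<K_2$, depending only on $\lambda$ and $K$, are fixed such that for each sequence $T_1,T_2,\ldots\in\mathcal{T}$ with corresponding $\mathcal{P}$ and $\tau$, each nonnegative measure $\mu$ on $Y$ with $|\mu|_{\mathrm{LL}}\le K_2$ and each $a\in\mathcal{P}$, $a\subset Y$, one has $|(T_{1,\tau(a)})_*(\mu|_a)|_{\mathrm{LL}}\le K_1$ (such constants exist and can be chosen arbitrarily large). A nonnegative measure $\mu$ on $X$ is regular if for every $T_1,T_2,\ldots\in\mathcal{T}$ with corresponding partition $\mathcal{P}$ and every $a\in\mathcal{P}$, $|(T_{1,\tau(a)})_*(\mu|_a)|_{\mathrm{LL}}\le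 K_1$. It has tail bound $r\colon\{0,1,\ldots\}\to[0,\infty)$ if, for every such sequence and all $n\ge0$, $\mu(\{x\in X:T_{1,k}(x)\notin Y\text{ for all }1\le k<n\})\le r(n)$.
   Formalization: The formal theorem also assumes that the tail bound satisfies inf r(n) = 0 (else no α determined by r and the constants can exist) and that a regular μ gives no mass to the set left uncovered by the partition 𝒫 (else Dirac masses off Y would be vacuously regular). *)

(* Defs.v *)
From HB Require Import structures.
From mathcomp Require Import all_boot all_order all_algebra.
From mathcomp Require Import all_classical all_reals all_analysis.

Set Implicit Arguments.
Unset Strict Implicit.
Unset Printing Implicit Defensive.

Import Order.TTheory GRing.Theory Num.Theory.
Import numFieldNormedType.Exports.

Local Open Scope classical_set_scope.
Local Open Scope ring_scope.
Local Open Scope ereal_scope.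

HB.mixin Record isBorel d (R : numDomainType) (X : Type)
    & Metric R X & Measurable d X := {
  measurable_borel : (@measurable d X : set (set X)) = <<s @open X >>
}.

#[short(type="borelMetricType")]
HB.structure Definition BorelMetric d (R : numDomainType) :=
  { X of Metric R X & Measurable d X & isBorel d R X }.

Section metric.
Context d (R : realType) (X : borelMetricType d R).

Definition distances : set R := range (fun z : X * X => mdist z.1 z.2).

Definition diam : R := sup distances.

Definition separable := exists2 S : set X, countable S & dense S.

Definition is_completion d' (Z : borelMetricType d' R) (i : X -> Z) :=
  [/\ forall x y, mdist (i x) (i y) = mdist x y,
      dense (range i)
    & forall F : set_system Z, ProperFilter F -> cauchy F -> cvg F].

(* The completion is unique up to isometry, so it does not matter which one
   is taken. *)
Definition universally_measurable :=
  exists d' (Z : borelMetricType d' R) (i : X -> Z), is_completion i /\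
    forall Q : probability Z R, exists2 A : set Z, measurable A &
      A `<=` range i /\ Q.-negligible (range i `\` A).

End metric.
Arguments distances {d R} X.
Arguments diam {d R} X.
Arguments separable {d R} X.
Arguments universally_measurable {d R} X.

Section log_lipschitz.
Context d (R : realType) (X : borelMetricType d R).
Variables (Y : set X) (m : probability X R).

(* [lne 0 = -oo], and [-oo - -oo = -oo] in [\bar R], hence the explicit case. *)
Definition log_diff (a b : R) : \bar R :=
  if (a == 0%R) && (b == 0%R) then 0 else `|lne a%:E - lne b%:E|.

Definition LLnorm (rho : X -> R) : \bar R :=
  ereal_sup [set log_diff (rho z.1) (rho z.2) * ((mdist z.1 z.2)^-1)%:E
            | z in [set z : X * X | [/\ Y z.1, Y z.2 & z.1 <> z.2]]].

Definition density (nu : set X -> \bar R) (rho : X -> R) :=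
  [/\ measurable_fun setT rho, forall x, (0 <= rho x)%R
    & forall A, measurable A -> nu A = \int[m]_(x in A) (rho x)%:E].

(* A density is only determined up to an [m]-null set, whereas the seminorm is
   a supremum over all points of [Y]: the bound is asked of some version. *)
Definition LL_le (nu : set X -> \bar R) (k : R) :=
  exists2 rho, density nu rho & LLnorm rho <= k%:E.

End log_lipschitz.

Record constants (R : realType) := Constants {
  cK1 : R; cK2 : R; cdiam : R; cK : R; clambda : R; cn0 : nat; cdelta0 : R }.

Section dynamics.
Context d (R : realType) (X : borelMetricType d R).
Implicit Types (T : nat -> X -> X) (a : set X).

(* [T 0, T 1, ...] stand for T_1, T_2, ..., so that [traj T n] is
   T_{1,n} = T_n o ... o T_1. *)
Fixpoint traj T (n : nat) : X -> X :=
  if n is k.+1 then T k \o traj T k else id.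

Definition tau (Y : set X) T (x : X) : \bar R :=
  ereal_inf [set (n%:R)%:E | n in [set n | (1 <= n)%N /\ Y (traj T n x)]].

Definition tau_on (Y : set X) T a (n : nat) :=
  forall x, a x -> tau Y T x = (n%:R)%:E.

(* The conditions on a sequence [T] and its partition [P].  As T_{1,tau(a)} is
   used for every [a] in [P], the constant value of tau on [a] is finite. *)
Record nonuniformly_expanding (c : constants R) (h : nat -> R) (Y : set X)
    (m : probability X R) T (P : set (set X)) : Prop := {
  P_countable : countable P;
  P_measurable : forall a, P a -> measurable a;
  P_partition : partition P id (cover P id);
  P_full : m (~` cover P id) = 0;
  P_Y : forall a, P a -> a `<=` Y \/ a `&` Y = set0;
  NU1 : forall a, P a -> a `<=` Y -> 0 < m a;
  NU2 : forall a, P a -> exists n, tau_on Y T a n;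
  NU3 : forall a (ma : measurable a) n, P a -> a `<=` Y -> tau_on Y T a n ->
    [/\ set_bij a Y (traj T n),
        forall y y', a y -> a y' ->
          (clambda c * mdist y y' <= mdist (traj T n y) (traj T n y'))%R
      & LL_le Y m (pushforward (mrestr m ma) (traj T n)) (cK c)];
  NU4 : forall a n, P a -> tau_on Y T a n -> forall x x', a x -> a x' ->
    forall j, (j <= n)%N ->
      (mdist (traj T j x) (traj T j x')
         <= cK c * mdist (traj T n x) (traj T n x'))%R;
  NU5 : forall n, m [set x | (n%:R)%:E <= tau Y T x] <= (h n)%:E;
  NU6 : \sum_(1 <= n <oo) (h n)%:E <= (cK c)%:E;
  NU7 : forall n, (cn0 c <= n)%N -> (cdelta0 c)%:E <= m (traj T n @^-1` Y)
}.

(* [P T] is the partition corresponding to the sequence [T]. *)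
Record setting (c : constants R) (h : nat -> R) (Y : set X)
    (m : probability X R) (TT : set (X -> X))
    (P : (nat -> X -> X) -> set (set X)) : Prop := {
  X_bounded : has_ubound (distances X);
  X_diam : cdiam c = diam X;
  X_separable : separable X;
  X_universally_measurable : universally_measurable X;
  Y_measurable : measurable Y;
  m_Y : m Y = 1;
  TT_measurable : forall f, TT f -> measurable_fun setT f;
  lambda_gt1 : (1 < clambda c)%R;
  K_gt0 : (0 < cK c)%R;
  delta0_gt0 : (0 < cdelta0 c)%R;
  n0_ge1 : (1 <= cn0 c)%N;
  h_ge0 : forall n, (0 <= h n)%R;
  TT_nue : forall T, (forall k, TT (T k)) ->
    nonuniformly_expanding c h Y m T (P T);
  K1_gt0 : (0 < cK1 c)%R;
  K1_lt_K2 : (cK1 c < cK2 c)%R;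
  K1_K2 : forall T, (forall k, TT (T k)) ->
    forall mu : {measure set X -> \bar R}, mu (~` Y) = 0 ->
    LL_le Y m mu (cK2 c) ->
    forall a (ma : measurable a) n, P T a -> a `<=` Y -> tau_on Y T a n ->
      LL_le Y m (pushforward (mrestr mu ma) (traj T n)) (cK1 c)
}.

(* The partitions are taken up to a null set; for a regular measure, which
   need not be absolutely continuous with respect to [m] (and [m] does not
   charge the complement of [Y]), this null set has to be null as well, for
   otherwise the remaining condition would not see part of the measure. *)
Definition regular (c : constants R) (Y : set X) (m : probability X R)
    (TT : set (X -> X)) (P : (nat -> X -> X) -> set (set X))
    (mu : set X -> \bar R) :=
  forall T, (forall k, TT (T k)) ->
    mu (~` cover (P T) id) = 0 /\
    forall a (ma : measurable a) n, P T a -> tau_on Y T a n ->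
      LL_le Y m (pushforward (mrestr mu ma) (traj T n)) (cK1 c).

Definition tail_bound (Y : set X) (TT : set (X -> X)) (mu : set X -> \bar R)
    (r : nat -> R) :=
  forall T, (forall k, TT (T k)) -> forall n,
    mu [set x | forall k, (1 <= k < n)%N -> ~ Y (traj T k x)] <= (r n)%:E.

End dynamics.

(* Main.v *)
Require Import Defs.
From mathcomp Require Import all_boot all_order all_algebra.
From mathcomp Require Import all_classical all_reals all_analysis.
From HB Require Import structures.
From mathcomp Require Import measurable_realfun ring lra zify.

Set Implicit Arguments.
Unset Strict Implicit.
Unset Printing Implicit Defensive.

Import Order.TTheory GRing.Theory Num.Theory.
Import numFieldNormedType.Exports.

Local Open Scope classical_set_scope.
Local Open Scope ring_scope.
Local Open Scope ereal_scope.

(* Follow the mass of mu along the trajectories.  Whatever lies in Y at time n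
   has a log-Lipschitz density, since it is a countable sum of pieces that
   return to Y from the time of their previous visit.  If alpha_n is at most a
   fixed fraction of the mass lying in Y at time n, then alpha_n * m can be
   split off there, the density of the rest stays log-Lipschitz with the larger
   constant K2, and pulling alpha_n * m back to time 0 gives alpha_n * mu_n.

   The alpha_n have to be chosen without knowing the system.  Let w_n be the
   mass left after time n.  The part of it that does not visit Y during
   a window [n - n0 - L, n - n0] is bounded by a quantity G_n computed from r,
   h and w_0, ..., w_(n-1); by (NU7) a fixed fraction of the part that does
   visit is back in Y at time n.  Hence alpha_n = kappa * max(0, w_(n-1) - G_n)
   is admissible, and w solves an explicit recursion.  Its decay follows by
   comparison with supersolutions.  Since G_n is linear in r and w, for
   polynomial tails it suffices to find one when r is the indicator of [0, s];
   averaging over s with the weights r(s) - r(s+1) produces the factor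
   sum_j r(j) in (2), and the coefficient 1 of r(n/2 - n0). *)

(** * The recursion for the remaining mass *)

(** The obstacle is that the window length L and the fraction kappa depend on all of h, while the
    constants in (1)-(3) may depend only on the bound assumed for h. So L is the least length for
    which the bounds for longer flights sum to at most 1/8: an assumed bound on h yields one such
    length L0, hence L <= L0, and kappa is nonincreasing in L. Supersolutions are built for the
    smaller fraction at L0, which the comparison allows. The value 1/8 leaves room for G <= W/2 even
    if the supersolution W doubles over a short flight; one step is then fine as soon as W loses at
    most the fraction k/2 in it, which is [half_contraction]. The splitting can be repeated because
    of the gap between K1 and K2: a removal worsens K1 to K2, and the next return to Y restores K1.
    At most half of the mass in Y is removed each time, so of the mass seen in the window a fixed
    share survives until it is back in Y. *)

Lemma half_contraction (R : realType) (k y v v' w g : R) :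
  (0 < k <= 1 -> 0 <= y <= k / 2 -> 0 <= v -> w <= v -> v * (1 - y) <= v' ->
  g <= v' / 2 -> (1 - k) * w + k * g <= v')%R.
Proof.
move=> /andP[k0 k1] /andP[y0 yk] v0 wv vv' gv.
have h1 : (0 <= (1 - k) * (v - w))%R by rewrite mulr_ge0// subr_ge0.
have h2 : (0 <= k * (v' / 2 - g))%R by rewrite mulr_ge0// ?subr_ge0// ltW.
have h3 : (0 <= (1 - k / 2) * (v' - v * (1 - y)))%R by rewrite mulr_ge0// subr_ge0//; lra.
have h4 : (0 <= v * ((1 - k / 2) * (k / 2 - y)))%R.
  by rewrite mulr_ge0// mulr_ge0// subr_ge0//; lra.
have h5 : (0 <= v * k ^+ 2)%R by rewrite mulr_ge0// sqr_ge0.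
lra.
Qed.

Lemma sum_flights (R : realType) (F : nat -> R) m q : (m <= q.+1)%N ->
  (\sum_(0 <= u < m) F (q - u).+1 = \sum_(q.+2 - m <= k < q.+2) F k)%R.
Proof.
elim: m => [|m IH] mq; first by rewrite subn0 !big_geq.
rewrite big_nat_recr//= IH; last by lia.
rewrite [RHS]big_ltn; last by lia.
rewrite addrC; congr (F _ + _)%R; first by lia.
by congr bigop; congr index_iota; lia.
Qed.

Section recursion.
Local Open Scope ring_scope.
Context (R : realType) (kappa : R) (H rho : nat -> R) (n0 L : nat).
Implicit Types (w W : nat -> R).

(* A bound for the mass that does not visit Y in the window [q - L, q], when w u
   is left at time u, the density of what lies in Y makes a flight last at least
   k with probability at most H k, and at most rho k does not enter Y before
   time k.  The mass counted by rho takes no part in the flights; subtracting it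
   there is what gives r the coefficient 1 in (2). *)
Definition flight_bound w (n : nat) : R :=
  let q := (n - n0)%N in
  rho q.+1 * (1 - \sum_(0 <= u < q - L) H (q - u).+1)
  + \sum_(0 <= u < q - L) w u * H (q - u).+1.

(** Course-of-values recursion, since a step uses all earlier values: [rem_history n i] is the mass
    left at time min(i, n). *)
Fixpoint rem_history (n : nat) : nat -> R :=
  if n is k.+1 then
    let w := rem_history k in
    fun i => if (i <= k)%N then w i
             else w k - kappa * Num.max 0 (w k - flight_bound w k.+1)
  else fun=> 1.

Definition remaining (n : nat) : R := rem_history n n.

Lemma rem_history_prefix n i : (i <= n)%N -> rem_history n i = remaining i.
Proof.
elim: n i => [|n IH] i; first by rewrite leqn0 => /eqP ->.
rewrite leq_eqVlt => /orP[/eqP -> //|]; rewrite ltnS => le_in.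
by rewrite /= le_in IH.
Qed.

Lemma eq_flight_bound w W n :
  (forall u, (u < n)%N -> w u = W u) -> flight_bound w n = flight_bound W n.
Proof.
move=> wW; rewrite /flight_bound; congr (_ + _).
rewrite !big_nat; apply: eq_bigr => u /andP[_ uq]; congr (_ * _).
by apply: wW; lia.
Qed.

Lemma remaining0 : remaining 0 = 1. Proof. by []. Qed.

Lemma remainingS n : remaining n.+1 = remaining n
  - kappa * Num.max 0 (remaining n - flight_bound remaining n.+1).
Proof.
rewrite {1}/remaining /= ltnn rem_history_prefix//.
rewrite (@eq_flight_bound (rem_history n) remaining)// => u.
by rewrite ltnS => /rem_history_prefix.
Qed.

Hypotheses (kappa0 : 0 <= kappa) (kappa1 : kappa <= 1).
Hypotheses (H0 : forall k, 0 <= H k) (rho0 : forall k, 0 <= rho k).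
Hypothesis flights_le :
  forall q, \sum_(0 <= u < q - L) H (q - u).+1 <= 8^-1.

Lemma remaining_noninc n : remaining n.+1 <= remaining n.
Proof. by rewrite remainingS gerBl mulr_ge0// le_max lexx. Qed.

Lemma remaining_homo m n : (m <= n)%N -> remaining n <= remaining m.
Proof.
elim: n => [|n IH]; first by rewrite leqn0 => /eqP ->.
rewrite leq_eqVlt => /orP[/eqP -> //|]; rewrite ltnS => /IH.
exact/le_trans/remaining_noninc.
Qed.

Lemma le_flight_bound w W n :
  (forall u, (u < n)%N -> w u <= W u) -> flight_bound w n <= flight_bound W n.
Proof.
move=> wW; rewrite /flight_bound lerD2l.
by apply: ler_sum_nat => u /andP[_ uq]; apply: ler_wpM2r => //; apply: wW; lia.
Qed.

Lemma flight_bound_ge0 w n : (forall u, (u < n)%N -> 0 <= w u) ->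
  0 <= flight_bound w n.
Proof.
move=> w0; rewrite /flight_bound addr_ge0//.
  by rewrite mulr_ge0// subr_ge0 (le_trans (flights_le _))//; lra.
rewrite big_nat; apply: sumr_ge0 => u /andP[_ uq]; apply: mulr_ge0 => //.
by apply: w0; lia.
Qed.

Lemma remaining_ge0 n : 0 <= remaining n.
Proof.
elim/ltn_ind: n => -[_|n IH]; first by rewrite remaining0.
rewrite remainingS.
have g0 : 0 <= flight_bound remaining n.+1.
  by apply: flight_bound_ge0 => u; exact: IH.
have := IH n (ltnSn n).
set x := remaining n; set g := flight_bound _ _ in g0 *.
have := mulr_ge0 kappa0 g0; move: kappa1; rewrite -subr_ge0 => k1.
by case: (leP 0 (x - g)) => _ kg x0; have := mulr_ge0 k1 x0; lra.
Qed.

Lemma remaining_le1 n : remaining n <= 1.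
Proof. by rewrite -remaining0 remaining_homo. Qed.

(** One step is (1 - kappa) w + kappa min(w, G(w)), which is monotone in w because kappa <= 1 and G
    is monotone in the history. The two conditions on W, for some k <= kappa, imply the one for
    kappa: if W >= G the right side decreases in kappa, otherwise G <= W at the next time suffices.
    The horizon M is there because the supersolution for polynomial tails depends on the time at
    which it is evaluated. *)
Lemma remaining_le W (k : R) M : 0 <= k <= kappa -> 1 <= W 0%N ->
  (forall n, (n < M)%N -> flight_bound W n.+1 <= W n.+1) ->
  (forall n, (n < M)%N ->
    (1 - k) * W n + k * flight_bound W n.+1 <= W n.+1) ->
  forall n, (n <= M)%N -> remaining n <= W n.
Proof.
move=> /andP[k0 kk] W0 WG WI; elim/ltn_ind => -[_ _|n IH nM]; first exact: W0.
have {}IH m : (m < n.+1)%N -> remaining m <= W m by move=> ?; apply: IH => //; lia.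
have gG : flight_bound remaining n.+1 <= flight_bound W n.+1.
  by apply: le_flight_bound => u; exact: IH.
move: (IH n (ltnSn n)) (WG n nM) (WI n nM) gG; rewrite remainingS.
set x := remaining n; set X := W n; set g := flight_bound remaining _.
set G := flight_bound W _; set Z := W _ => xX GZ XGZ gG.
have [gx|xg] := leP 0 (x - g); last by rewrite mulr0; lra.
move: kappa1; rewrite -subr_ge0 => k1.
have a1 : 0 <= (1 - kappa) * (X - x) by rewrite mulr_ge0// subr_ge0.
have a2 : 0 <= kappa * (G - g) by rewrite mulr_ge0// subr_ge0.
have [XG|GX] := leP X G.
  have : 0 <= (1 - kappa) * (G - X) by rewrite mulr_ge0// subr_ge0.
  lra.
have : 0 <= (kappa - k) * (X - G) by rewrite mulr_ge0// subr_ge0// ltW.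
lra.
Qed.

(** Otherwise the infimum I is positive. Late enough, [rho] contributes at most I/8 to the flight
    bound, the flights from before n1 at most I/8, and those from after n1, where w < 2I, at most
    2I/8. Every step then removes at least kappa I/2, which cannot go on forever. *)
Lemma remaining_arbitrarily_small : 0 < kappa ->
  (forall e, 0 < e -> exists n, forall k, (n <= k)%N -> rho k < e) ->
  (forall e, 0 < e -> exists n, forall k, \sum_(n <= i < k) H i < e) ->
  forall e, 0 < e -> exists n, remaining n < e.
Proof.
move=> kp rhoV HV e e0; apply: contrapT => /forallNP eN.
have ew n : e <= remaining n by rewrite leNgt; apply/negP/eN.
pose A := range remaining; have hA : has_inf A.
  split; first by exists (remaining 0); exists 0%N.
  by exists 0 => _ [n _ <-]; exact: remaining_ge0.
pose I := inf A.
have Iw n : I <= remaining n by apply: ge_inf; [exact: hA.2|exists n].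
have I0 : 0 < I.
  by apply: (lt_le_trans e0); apply: lb_le_inf => [|_ [n _ <-]//]; exact: hA.1.
have [_ [n1 _ <-] wn1] := inf_adherent I0 hA; rewrite -/I in wn1.
have [n2 rhoI] := rhoV _ (divr_gt0 I0 (ltr0n _ 8)).
have [n3 HI] := HV _ (divr_gt0 I0 (ltr0n _ 8)).
pose N := (n0 + L + n1 + n2 + n3)%N.
have step n : (N <= n)%N -> remaining n.+1 <= remaining n - kappa * (I / 2).
  move=> Nn; rewrite remainingS lerD2l lerN2 ler_wpM2l// le_max; apply/orP; right.
  suff : flight_bound remaining n.+1 <= I / 2 by move: (Iw n); lra.
  rewrite /flight_bound; set q := (n.+1 - n0)%N.
  have r1 : rho q.+1 * (1 - \sum_(0 <= u < q - L) H (q - u).+1) <= I / 8.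
    apply: (@le_trans _ _ (rho q.+1)); last by apply/ltW/rhoI; lia.
    rewrite ler_piMr// gerBl big_nat; exact: sumr_ge0.
  have r2 : \sum_(0 <= u < q - L) remaining u * H (q - u).+1 <= I / 8 + 2 * I / 8.
    rewrite (@big_cat_nat _ _ _ n1)//=; last by lia.
    apply: lerD.
      apply: (@le_trans _ _ (\sum_(0 <= u < n1) H (q - u).+1)).
        by apply: ler_sum => u _; rewrite ler_piMl// remaining_le1.
      rewrite sum_flights; last by lia.
      apply: (@le_trans _ _ (\sum_(n3 <= k < q.+2) H k)); last exact/ltW/HI.
      rewrite [leRHS](@big_cat_nat _ _ _ (q.+2 - n1))/=; try by lia.
      by rewrite lerDr sumr_ge0.
    apply: (@le_trans _ _ (\sum_(n1 <= u < q - L) (2 * I) * H (q - u).+1)).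
      apply: ler_sum_nat => u /andP[n1u _]; apply: ler_wpM2r => //.
      by rewrite (le_trans (remaining_homo n1u))//; move: wn1; lra.
    rewrite -mulr_sumr ler_wpM2l//; first by rewrite mulr_ge0// ltW.
    apply: (le_trans _ (flights_le q)).
    rewrite [leRHS](@big_cat_nat _ _ _ n1)//=; last by lia.
    by rewrite lerDr sumr_ge0.
  move: r1 r2; lra.
have c0 : 0 < kappa * (I / 2) by rewrite mulr_gt0// divr_gt0.
have iter m : remaining (N + m) <= 1 - m%:R * (kappa * (I / 2)).
  elim: m => [|m IHm]; first by rewrite mul0r subr0 addn0 remaining_le1.
  rewrite addnS (le_trans (step _ _))//; first by lia.
  by rewrite -[m.+1]addn1 natrD mulrDl mul1r; move: IHm; lra.
set c := kappa * _ in iter c0.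
have ic0 : 0 <= c^-1 by rewrite invr_ge0 ltW.
have := archi_boundP ic0; set b := Num.bound _.
have := iter b; have := remaining_ge0 (N + b).
rewrite -[c^-1 < _](ltr_pM2r c0) mulVf ?gt_eqF//; lra.
Qed.

End recursion.

(** * Decay of powers *)

Section power_decay.
Local Open Scope ring_scope.
Context (R : realType).
Implicit Types (a b c x : R).

Lemma powRN_gt0 b (n : nat) : (0 < n)%N -> 0 < n%:R `^ (- b) :> R.
Proof. by move=> n0; rewrite powR_gt0// ltr0n. Qed.

Lemma powRN_noninc b (m n : nat) : 0 <= b -> (0 < m <= n)%N ->
  n%:R `^ (- b) <= m%:R `^ (- b) :> R.
Proof.
move=> b0 /andP[m0 mn]; rewrite !powRN lef_pV2 ?posrE ?powR_gt0 ?ltr0n//; last by lia.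
by rewrite ge0_ler_powR ?nnegrE ?ler0n ?ler_nat.
Qed.

Lemma powRN_scale b c (m n : nat) : 0 <= b -> 0 < c -> (0 < n)%N ->
  n%:R <= c * m%:R -> m%:R `^ (- b) <= c `^ b * n%:R `^ (- b).
Proof.
move=> b0 c0 n0 nm; have m0 : 0 < m%:R :> R.
  by rewrite -(pmulr_rgt0 _ c0) (lt_le_trans _ nm)// ltr0n.
rewrite !powRN ler_pdivlMr ?powR_gt0 ?ltr0n// mulrC ler_pdivrMr ?powR_gt0//.
rewrite -powRM ?ler0n ?(ltW c0)// ge0_ler_powR ?nnegrE ?ler0n ?mulr_ge0 ?ler0n//.
exact: ltW.
Qed.

(** Bernoulli for the integer exponent B by induction; since 0 <= 1 - x <= 1, lowering the exponent
    to b only increases the power. *)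
Lemma powR_Bernoulli b (B : nat) x : b <= B%:R -> (0 < B)%N -> 0 <= x <= 1 ->
  1 - B%:R * x <= (1 - x) `^ b.
Proof.
move=> bB B0 /andP[x0 x1]; have [->|xn1] := eqVneq x 1.
  by rewrite mulr1 (le_trans _ (powR_ge0 _ _))// subr_le0 ler1n.
have y0 : 0 < 1 - x by rewrite subr_gt0 lt_neqAle xn1.
apply: (@le_trans _ _ ((1 - x) ^+ B)).
  elim: B {bB B0} => [|B IH]; first by rewrite mul0r subr0 expr0.
  rewrite exprS -[B.+1]addn1 natrD mulrDl mul1r.
  apply: (@le_trans _ _ ((1 - x) * (1 - B%:R * x))); last by rewrite ler_wpM2l// ltW.
  have : 0 <= B%:R * x ^+ 2 by rewrite mulr_ge0// sqr_ge0.
  lra.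
rewrite -powR_mulrn ?(ltW y0)//; apply: ger_powR => //.
by rewrite y0 gerBl.
Qed.

(** Bernoulli at 1 - x = m / n. It serves twice below: for a single step, and to see that the kernel
    at most doubles over a short flight. *)
Lemma powRN_ratio b (B m n : nat) : b <= B%:R -> (0 < B)%N ->
  (0 < m <= n)%N ->
  m%:R `^ (- b) * (1 - B%:R * (1 - m%:R / n%:R)) <= n%:R `^ (- b).
Proof.
move=> bB B0 /andP[m0 mn]; have n0 : (0 < n)%N by lia.
have mp : 0 < m%:R :> R by rewrite ltr0n.
have np : 0 < n%:R :> R by rewrite ltr0n.
have -> : n%:R `^ (- b) = m%:R `^ (- b) * (m%:R / n%:R) `^ b :> R.
  rewrite powRM ?ler0n ?invr_ge0 ?ler0n// mulrA -powRD; last by rewrite addNr eqxx gt_eqF.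
  by rewrite addNr powRr0 mul1r -powR_inv1 ?ler0n// -powRrM mulN1r.
rewrite ler_wpM2l ?powR_ge0//.
have y01 : 0 <= (1 - m%:R / n%:R : R) <= 1.
  rewrite subr_ge0 ler_pdivrMr// mul1r ler_nat mn/=.
  by rewrite gerBl divr_ge0// ltW.
by have := powR_Bernoulli bB B0 y01; rewrite opprB subrKC.
Qed.

(** The integral comparison in telescoped form: with a = b - 1, a k^-b <= (k-1)^-a - k^-a, because
    (1 - 1/k)^-a >= 1 + a/k. *)
Lemma sum_powRN_le b (I M : nat) : 1 < b -> (0 < I)%N ->
  \sum_(I.+1 <= k < M) k%:R `^ (- b) <= (b - 1)^-1 * I%:R `^ (- (b - 1)) :> R.
Proof.
move=> b1 I0; set a := b - 1; have a0 : 0 < a by rewrite subr_gt0.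
have [MI|IM] := leqP M I.+1.
  by rewrite big_geq// mulr_ge0 ?powR_ge0// invr_ge0 ltW.
apply: (@le_trans _ _ (a^-1 * (I%:R `^ (- a) - M.-1%:R `^ (- a)))); last first.
  by rewrite ler_wpM2l ?invr_ge0 ?(ltW a0)// gerBl powR_ge0.
have -> : I%:R `^ (- a) - M.-1%:R `^ (- a) = 
    \sum_(I.+1 <= k < M) (k.-1%:R `^ (- a) - k%:R `^ (- a)) :> R.
  have := @telescope_sumr _ I.+1 M (fun k => - (k.-1%:R `^ (- a)) : R) (ltnW IM).
  rewrite opprK addrC => <-.
  by apply: eq_bigr => k _; rewrite opprK addrC.
rewrite mulr_sumr; apply: ler_sum_nat => k /andP[Ik _].
have k0 : 0 < k%:R :> R by rewrite ltr0n; lia.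
have k1 : 0 < k.-1%:R :> R by rewrite ltr0n; lia.
rewrite ler_pdivlMl// lerBrDr.
have -> : - b = - a + (- 1) by rewrite /a; lra.
have kn0 : k%:R != 0 :> R by rewrite gt_eqF.
rewrite powRD; last by rewrite kn0; case: eqP.
rewrite powR_inv1 ?(ltW k0)// mulrCA -[X in _ + X]mulr1 -mulrDr.
have -> : k.-1%:R `^ (- a) = k%:R `^ (- a) * (k.-1%:R / k%:R) `^ (- a) :> R.
  by rewrite -powRM ?ler0n ?divr_ge0 ?ler0n// mulrC divfK ?gt_eqF.
rewrite ler_wpM2l ?powR_ge0// addrC.
rewrite (le_trans (expR_ge1Dx _))// /powR gt_eqF ?divr_gt0// ler_expR.
rewrite mulNr -mulrN ler_wpM2l ?(ltW a0)//.
have -> : k.-1%:R / k%:R = 1 + - k%:R^-1 :> R.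
  have -> : k.-1%:R = k%:R - 1 :> R.
    by rewrite -[in RHS](prednK (_ : 0 < k)%N) -?natr1 ?addrK//; lia.
  by rewrite mulrDl mulfV ?gt_eqF// mulN1r.
rewrite lerNr le_ln1Dx// ltrN2 invf_lt1// ltr1n; lia.
Qed.

Lemma sum_powRN_tail b : 1 < b -> forall e : R, 0 < e -> exists2 I, (0 < I)%N &
  forall M, \sum_(I <= k < M) k%:R `^ (- b) <= e.
Proof.
move=> b1 e e0; have a0 : 0 < b - 1 by rewrite subr_gt0.
(* The solution of (b - 1)^-1 x^-(b - 1) = e. *)
pose x := (e * (b - 1)) `^ (- (b - 1)^-1).
exists (Num.bound x).+2 => // M.
apply: (le_trans (sum_powRN_le _ _ _)) => //.
rewrite ler_pdivrMl// mulrC.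
have x0 : 0 < x by rewrite powR_gt0// mulr_gt0.
have -> : e * (b - 1) = x `^ (- (b - 1)).
  by rewrite -powRrM mulrN mulNr opprK mulVf ?gt_eqF// powRr1// ltW// mulr_gt0.
rewrite !powRN lef_pV2 ?posrE ?powR_gt0 ?ltr0n//.
rewrite ge0_ler_powR ?nnegrE ?ler0n ?(ltW x0) ?(ltW a0)//.
by rewrite ltW// (lt_trans (archi_boundP (ltW x0)))// ltr_nat.
exact: mulr_gt0.
Qed.

Lemma sum_powRN_bounded b : 1 < b -> exists2 Z : R, 0 < Z &
  forall M, \sum_(1 <= k < M) k%:R `^ (- b) <= Z.
Proof.
move=> b1; exists (1 + (b - 1)^-1) => [|M].
  by rewrite addr_gt0// invr_gt0 subr_gt0.
have [M1|M1] := leqP M 1; first by rewrite big_geq// addr_ge0// invr_ge0 subr_ge0 ltW.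
rewrite big_ltn// powR1 lerD2l (le_trans (sum_powRN_le _ _ _))//.
by rewrite powR1 mulr1.
Qed.

End power_decay.

(** * Polynomial tails *)

Section polynomial_kernel.
Local Open Scope ring_scope.
Context (R : realType).

(* The supersolution for rho the indicator function of [0, s]. *)
Definition poly_kernel (A b : R) (n0 s n : nat) : R :=
  if (n <= s + n0)%N then 1
  else Num.min 1 (A * s%:R * (n - s - n0)%:R `^ (- b)).

Lemma poly_kernel_ge0 A b n0 s n : 0 <= A -> 0 <= poly_kernel A b n0 s n.
Proof.
move=> A0; rewrite /poly_kernel; case: ifP => // _.
by rewrite le_min ler01/= !mulr_ge0// powR_ge0.
Qed.

Lemma poly_kernel_le1 A b n0 s n : poly_kernel A b n0 s n <= 1.
Proof. by rewrite /poly_kernel; case: ifP => // _; rewrite ge_min lexx. Qed.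

Lemma poly_kernel_le A b n0 s n : (s + n0 < n)%N ->
  poly_kernel A b n0 s n <= A * s%:R * (n - s - n0)%:R `^ (- b).
Proof. by move=> sn; rewrite /poly_kernel leqNgt sn/= ge_min lexx orbT. Qed.

(** The terms before s + n0 + I count at most 1 each; from there on a tail of the power series makes
    the share of A as small as e. For s >= 1 the total is thus linear in s, like the kernel
    itself. *)
Lemma sum_poly_kernel_le (A b e : R) (n0 s I q : nat) : 0 <= A -> (0 < I)%N ->
  (forall M, \sum_(I <= k < M) k%:R `^ (- b) <= e) ->
  \sum_(0 <= u < q) poly_kernel A b n0 s u <= (s + n0 + I)%:R + A * s%:R * e.
Proof.
move=> A0 I0 eI; have e0 : 0 <= e by have := eI I; rewrite big_geq.
have Ae : 0 <= A * s%:R * e by rewrite !mulr_ge0.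
have triv m : \sum_(0 <= u < m) poly_kernel A b n0 s u <= m%:R.
  rewrite (le_trans (ler_sum _ (fun u _ => poly_kernel_le1 A b n0 s u)))//.
  by rewrite sumr_const_nat subn0.
have [qm|mq] := leqP q (s + n0 + I).
  by rewrite (le_trans (triv q))// ler_wpDr// ler_nat.
rewrite (@big_cat_nat _ _ _ (s + n0 + I)) ?(ltnW mq)//= lerD//.
apply: (@le_trans _ _ (\sum_(s + n0 + I <= u < q)
    A * s%:R * (u - s - n0)%:R `^ (- b))).
  by apply: ler_sum_nat => u /andP[Iu _]; apply: poly_kernel_le; lia.
rewrite -mulr_sumr ler_wpM2l ?mulr_ge0//.
rewrite -{1}[(s + n0 + I)%N]add0n big_addn.
apply: le_trans (eI (q - s - n0)%N).
have -> : \sum_(I <= k < q - s - n0) k%:R `^ (- b)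
    = \sum_(0 <= k < q - s - n0 - I) (k + I)%:R `^ (- b) :> R.
  by rewrite -{1}[I]add0n big_addn.
have -> : (q - s - n0 - I = q - (s + n0 + I))%N by lia.
by apply: ler_sum => u _; rewrite (_ : (_ - s - n0 = u + I)%N)//; lia.
Qed.

(** Let j = n + 1 - s - n0 be the age. A long flight has [H] of order j^-b, and the kernel has a
    total of order s, so long flights cost a multiple of s j^-b that a large A turns into a quarter
    of the kernel. Short flights start where the kernel is at most twice as large, and their total
    probability 1/8 makes this another quarter. It matters that A is chosen before [H], [L] and
    s. *)
Lemma poly_kernel_supersolution (b CH k0 : R) (n0 : nat) :
  1 < b -> 0 <= CH -> 0 < k0 <= 1 ->
  exists2 A, 1 <= A & forall H L, (forall k, 0 <= H k) ->
    (forall k, (0 < k)%N -> H k <= CH * k%:R `^ (- b)) ->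
    (forall q, \sum_(0 <= u < q - L) H (q - u).+1 <= 8^-1) ->
    forall s n, (0 < s)%N -> let W := poly_kernel A b n0 s in
      let G := flight_bound H (fun k => (k <= s)%N%:R) n0 L W n.+1 in
      G <= W n.+1 /\ (1 - k0) * W n + k0 * G <= W n.+1.
Proof.
move=> b1 CH0 /andP[k00 k01].
have b0 : 0 <= b by rewrite ltW// (lt_trans _ b1).
pose B := Num.bound b; have bB : b <= B%:R by apply/ltW/archi_boundP.
have B0 : (0 < B)%N by rewrite -(ltr0n R) (lt_le_trans _ bB)// (lt_trans _ b1).
(* At age j a flight is long if it takes more than j / D steps; then [H] is at most E j^-b. With D =
   4B the kernel at most doubles over a short flight. *)
pose D := (4 * B)%N; have D0 : (0 < D)%N by rewrite muln_gt0.
pose E := CH * D%:R `^ b; have E0 : 0 <= E by rewrite mulr_ge0// powR_ge0.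
(* Both E * e <= 1/8 and E (1 + n0 + I) <= A1/8 hold, so the long flights cost at most a quarter of
   the kernel. *)
pose e := (8 * (E + 1))^-1; have e0 : 0 < e by rewrite invr_gt0 mulr_gt0// ltr_wpDl.
have [I I0 eI] := sum_powRN_tail b1 e0.
(* At ages below J the kernel is 1, because A >= J^b. From J on, n0 <= j / D, and one step loses at
   most the fraction B / j <= k0 / 2. *)
pose J := (D * n0 + Num.bound (2 * B%:R / k0) + 2)%N.
pose A1 := 8 * (E + 1) * (1 + n0 + I)%:R.
have A10 : 0 <= A1 by rewrite !mulr_ge0// addr_ge0.
exists (1 + A1 + J%:R `^ b) => [|H L H0 HCH HL s n s0 W G].
  by rewrite -addrA lerDl addr_ge0// powR_ge0.
set A := 1 + A1 + _ in W G *.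
have A0 : 0 < A by rewrite ltr_pwDl ?powR_ge0// ltr_wpDr.
have sumH q : 0 <= \sum_(0 <= u < q - L) H (q - u).+1 by exact: sumr_ge0.
have G1 : G <= 1.
  rewrite /G /flight_bound; set q := (n.+1 - n0)%N.
  have := HL q; have := sumH q; set S := \sum_(_ <= _ < _) H _ => S0 S8.
  have : \sum_(0 <= u < q - L) W u * H (q - u).+1 <= S.
    by apply: ler_sum => u _; rewrite ler_piMl// poly_kernel_le1.
  by case: leqP => _; rewrite ?mul1r ?mul0r; lra.
have [W1|Wn1] := eqVneq (W n.+1) 1.
  rewrite W1; split => //; have Wn : W n <= 1 by exact: poly_kernel_le1.
  have : 0 <= (1 - k0) * (1 - W n) by rewrite mulr_ge0 ?subr_ge0.
  have : 0 <= k0 * (1 - G) by rewrite mulr_ge0 ?subr_ge0 ?(ltW k00).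
  lra.
have sn : (s + n0 < n.+1)%N.
  by rewrite ltnNge; apply/negP => sn; move: Wn1; rewrite /W /poly_kernel sn eqxx.
pose j := (n.+1 - s - n0)%N; have j0 : (0 < j)%N by rewrite /j; clear -sn; lia.
pose f (i : nat) : R := i%:R `^ (- b).
have fj0 : 0 < f j by exact: powRN_gt0.
have [WE Afj] : W n.+1 = A * s%:R * f j /\ A * s%:R * f j < 1.
  move: Wn1; rewrite /W /poly_kernel leqNgt sn/= -/j -/(f j).
  by case: leP => // _; rewrite eqxx.
have s1 : 1 <= s%:R :> R by rewrite ler1n.
have Jj : (J <= j)%N.
  rewrite leqNgt; apply/negP => jJ; move: Afj; apply/negP; rewrite -leNgt.
  apply: (@le_trans _ _ (J%:R `^ b * f J)).
    by rewrite /f powRN mulfV// gt_eqF// powR_gt0// ltr0n /J addnS.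
  apply: ler_pM; rewrite ?powR_ge0//.
    rewrite -[leLHS]mulr1; apply: ler_pM; rewrite ?powR_ge0//.
    by rewrite lerDr addr_ge0.
  by apply: powRN_noninc => //; rewrite j0 ltnW.
have [DJ BJ J2] : [/\ (D * n0 <= j)%N, (Num.bound (2 * B%:R / k0) <= j)%N & (2 <= j)%N].
  by split; apply: leq_trans Jj; rewrite /J; clear; lia.
have q_eq : (n.+1 - n0 = s + j)%N by rewrite /j; clear -sn; lia.
pose i := (j %/ D)%N.
have iD : (i * D <= j)%N by rewrite /i leq_trunc_div.
have ij : (i <= j)%N by exact: leq_div.
have jD : (j < i.+1 * D)%N by rewrite /i ltn_ceil.
have n0i : (n0 <= i)%N by rewrite /i leq_divRL// mulnC.
have half : G <= W n.+1 / 2.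
  rewrite /G /flight_bound q_eq.
  have -> : ((s + j).+1 <= s)%N = false by clear; lia.
  rewrite mul0r add0r.
  pose F u := E * f j * W u + 2 * (A * s%:R * f j) * H (s + j - u).+1.
  apply: (@le_trans _ _ (\sum_(0 <= u < s + j - L) F u)).
    apply: ler_sum_nat => u /andP[_ uq]; rewrite /F.
    have Wu0 : 0 <= W u by apply/poly_kernel_ge0/ltW.
    have W20 : 0 <= 2 * (A * s%:R * f j) by rewrite !mulr_ge0// ltW.
    have [us|su] := leqP u (s + j - i).
      apply: ler_wpDr; first by rewrite mulr_ge0.
      rewrite mulrC ler_wpM2r//.
      rewrite (le_trans (HCH _ _))// /E -mulrA ler_wpM2l//.
      apply: powRN_scale; rewrite ?ltr0n//.
      rewrite -natrM ler_nat; apply: (@leq_trans (i.+1 * D)%N); first exact: ltnW.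
      rewrite mulnC leq_mul2l; apply/orP; right.
      by move: us ij; clearbody i j; clear; lia.
    apply: ler_wpDl; first by rewrite !mulr_ge0// ltW.
    rewrite ler_wpM2r//.
    have i_le : (4 * i * B <= j)%N by rewrite (leq_trans _ iD)// /D mulnCA mulnA.
    have i2j : (2 * i < j)%N.
      have [i00|ip] := posnP i; first by rewrite i00.
      apply: (@leq_trans (4 * i)%N); first by move: ip; clearbody i; clear; lia.
      by rewrite (leq_trans _ i_le)// leq_pmulr.
    (* The time u is after s + j - i and n0 <= i, so its age is at least j - 2i; as 2iB <= j/2, the
       power there is at most twice that at j. *)
    pose m := (j - 2 * i)%N; have m0 : (0 < m <= j)%N.
      by rewrite /m; move: i2j; clearbody i; clear; lia.
    rewrite (le_trans (poly_kernel_le _ _ _))//.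
      by move: su i2j n0i; clearbody i j; clear; lia.
    rewrite mulrCA ler_wpM2l ?mulr_ge0 ?(ltW A0)//.
    apply: (@le_trans _ _ (f m)).
      apply: powRN_noninc => //; rewrite /m.
      by move: su uq i2j n0i; clearbody i j; clear; lia.
    have := powRN_ratio bB B0 m0.
    rewrite -/(f m) -/(f j).
    have jp : 0 < j%:R :> R by rewrite ltr0n.
    have -> : 1 - m%:R / j%:R = (2 * i)%:R / j%:R :> R.
      rewrite /m natrB; last exact: ltnW.
      by rewrite mulrBl mulfV ?gt_eqF//; lra.
    have : B%:R * ((2 * i)%:R / j%:R) <= 2^-1 :> R.
      rewrite mulrA ler_pdivrMr// ler_pdivlMl// -!natrM ler_nat.
      by move: i_le; clearbody B i; clear; lia.
    set y := B%:R * _ => y2 fy.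
    have : 0 <= f m * (2^-1 - y) by rewrite mulr_ge0 ?powR_ge0// subr_ge0.
    lra.
  rewrite /F big_split/= -!mulr_sumr WE.
  have h1 : \sum_(0 <= u < s + j - L) W u <= s%:R * ((1 + n0 + I)%:R + A * e).
    rewrite (le_trans (sum_poly_kernel_le _ _ _ (ltW A0) I0 eI))//.
    rewrite mulrDr mulrCA [s%:R * _]mulrC mulrA lerD2r -natrM ler_nat.
    by clear -s0; nia.
  have h2 := HL (s + j)%N.
  have h3 : E * ((1 + n0 + I)%:R + A * e) <= A / 4.
    have E1 : 0 < 8 * (E + 1) by rewrite mulr_gt0// ltr_wpDl.
    have eE : E * e <= 8^-1.
      have : e * (8 * (E + 1)) = 1 by rewrite mulVf// gt_eqF.
      by move: e0; lra.
    have c0 : 0 <= (1 + n0 + I)%:R :> R by [].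
    have : 0 <= A * (8^-1 - E * e) by rewrite mulr_ge0 ?(ltW A0)// subr_ge0.
    have A1A : A1 <= A by rewrite /A addrAC lerDr addr_ge0// powR_ge0.
    move: A1A; rewrite {1}/A1; set c := (1 + n0 + I)%:R in c0 *; lra.
  have fs0 : 0 <= f j * s%:R by rewrite mulr_ge0// ltW.
  have W20 : 0 <= 2 * (A * s%:R * f j) by rewrite !mulr_ge0// ltW.
  apply: (@le_trans _ _ (E * f j * (s%:R * ((1 + n0 + I)%:R + A * e))
      + 2 * (A * s%:R * f j) * 8^-1)).
    by rewrite lerD// ler_wpM2l// mulr_ge0// ltW.
  have : 0 <= f j * s%:R * (A / 4 - E * ((1 + n0 + I)%:R + A * e)).
    by rewrite mulr_ge0// subr_ge0.
  by lra.
split; first by rewrite (le_trans half)// ler_pdivrMr// ler_peMr ?ler1n// WE !mulr_ge0// ltW.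
have j1 : (0 < j.-1 <= j)%N by clear -J2; lia.
have Wn : W n <= A * s%:R * f j.-1.
  have -> : j.-1 = (n - s - n0)%N by rewrite /j; clear; lia.
  by apply: poly_kernel_le; move: J2; rewrite /j; clear; lia.
have := powRN_ratio bB B0 j1; rewrite -/(f j) -/(f j.-1).
have jp : 0 < j%:R :> R by rewrite ltr0n.
have -> : 1 - j.-1%:R / j%:R = j%:R^-1 :> R.
  have -> : j.-1%:R = j%:R - 1 :> R by rewrite -[in RHS](prednK j0) -natr1 addrK.
  by rewrite mulrBl mulfV ?gt_eqF// mul1r subKr.
have Bj : B%:R / j%:R <= k0 / 2.
  have : 2 * B%:R / k0 <= j%:R.
    rewrite ltW// (lt_le_trans (archi_boundP _)) ?divr_ge0 ?mulr_ge0 ?(ltW k00)//.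
    by rewrite ler_nat.
  by rewrite !ler_pdivrMr//; lra.
set y := B%:R / _ in Bj * => fy.
have f10 : 0 <= f j.-1 by exact: powR_ge0.
have As0 : 0 <= A * s%:R by rewrite mulr_ge0// ltW.
apply: (@half_contraction _ k0 y (A * s%:R * f j.-1)) => //.
- by rewrite k00.
- by rewrite Bj andbT divr_ge0.
- by rewrite mulr_ge0.
- by rewrite WE -mulrA ler_wpM2l.
Qed.
End polynomial_kernel.

(** * Mixtures of the kernels *)

Section polynomial_tail.
Local Open Scope ring_scope.
Context (R : realType).

(** Writes [rho] up to n + 1 as the constant [rho n.+1] plus a mixture of the indicators of
    [0, s]. *)
Lemma sum_drop (rho : nat -> R) (k n : nat) : (0 < k <= n.+1)%N ->
  \sum_(1 <= s < n.+1) (rho s - rho s.+1) * (k <= s)%N%:R = rho k - rho n.+1.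
Proof.
move=> /andP[k0 kn]; rewrite (@big_cat_nat _ _ _ k)//=.
rewrite big_nat_cond big1 ?add0r; last first.
  by move=> s /andP[/andP[_ sk] _]; rewrite leqNgt sk mulr0.
rewrite -[RHS]opprB -(telescope_sumr rho kn) -sumrN.
by apply: eq_big_nat => s /andP[ks _]; rewrite ks mulr1 opprB.
Qed.

(** Summation by parts, with the boundary term dropped. The factor s of the kernel, averaged with
    these weights, becomes the sum of [rho]. *)
Lemma sum_drop_index_le (rho : nat -> R) (k : nat) : (forall s, 0 <= rho s) ->
  \sum_(1 <= s < k.+1) (rho s - rho s.+1) * s%:R <= \sum_(1 <= s < k.+1) rho s.
Proof.
move=> rho0; suff : \sum_(1 <= s < k.+1) (rho s - rho s.+1) * s%:R
    <= \sum_(1 <= s < k.+1) rho s - k%:R * rho k.+1.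
  by move=> /le_trans; apply; rewrite gerBl mulr_ge0.
elim: k => [|k IH]; first by rewrite !big_geq// mul0r subr0.
rewrite big_nat_recr//= [X in _ <= X - _]big_nat_recr//=.
have -> : k.+1%:R = k%:R + 1 :> R by rewrite natr1.
by move: IH; lra.
Qed.

(** In the mixture the kernels with s > k, of total weight at most [rho k.+1], are bounded by 1, and
    those with s <= k by their power tail. The cut k stays free; the applications take it near n/2 -
    n0. *)
Lemma remaining_poly_le (b CH k0 : R) (n0 : nat) :
  1 < b -> 0 <= CH -> 0 < k0 <= 1 ->
  exists2 A, 1 <= A & forall kappa H rho L, k0 <= kappa <= 1 ->
    (forall k, 0 <= H k) ->
    (forall k, (0 < k)%N -> H k <= CH * k%:R `^ (- b)) ->
    (forall q, \sum_(0 <= u < q - L) H (q - u).+1 <= 8^-1) ->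
    (forall k, 0 <= rho k) -> (forall k, rho k.+1 <= rho k) -> rho 1%N = 1 ->
    forall n k, (k + n0 < n)%N ->
    remaining kappa H rho n0 L n
      <= rho k.+1 + A * (\sum_(1 <= s < k.+1) rho s) * (n - k - n0)%:R `^ (- b).
Proof.
move=> b1 CH0 k01; have [A A1 superA] := poly_kernel_supersolution n0 b1 CH0 k01.
have b0 : 0 <= b by rewrite ltW// (lt_trans _ b1).
have A0 : 0 <= A by rewrite (le_trans _ A1).
exists A => // kappa H rho L /andP[k0k k1] H0 HCH HL rho0 rhoV rho1 n k kn.
have {superA}super := superA H L H0 HCH HL.
pose p s := rho s - rho s.+1; have p0 s : 0 <= p s by rewrite subr_ge0.
(* The last summand stands for all s > n, whose kernels are 1 up to time n. The flight bound
   reproduces this constant exactly, because the mass counted by [rho] is subtracted from the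
   flights. *)
pose W m := \sum_(1 <= s < n.+1) p s * poly_kernel A b n0 s m + rho n.+1.
have kap0 : 0 <= kappa by rewrite (le_trans _ k0k)//; case/andP: k01 => /ltW.
have WG m : (m < n)%N -> flight_bound H rho n0 L W m.+1 =
    \sum_(1 <= s < n.+1) p s * flight_bound H (fun k => (k <= s)%N%:R) n0 L
      (poly_kernel A b n0 s) m.+1 + rho n.+1.
  move=> mn; rewrite /flight_bound; set q := (m.+1 - n0)%N.
  have := @sum_drop rho q.+1 n; rewrite -/(p _) => drop.
  have -> : rho q.+1 = \sum_(1 <= s < n.+1) p s * (q < s)%N%:R + rho n.+1.
    by rewrite drop ?subrK//= ltnS; rewrite /q; clear -mn; lia.
  set S := \sum_(_ <= _ < _) H _.
  have -> : \sum_(0 <= u < q - L) W u * H (q - u).+1 =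
      \sum_(1 <= s < n.+1) p s * (\sum_(0 <= u < q - L)
        poly_kernel A b n0 s u * H (q - u).+1) + rho n.+1 * S.
    rewrite /S mulr_sumr.
    under [X in _ = X + _]eq_bigr do rewrite mulr_sumr.
    rewrite exchange_big/= -big_split/=; apply: eq_bigr => u _.
    rewrite /W mulrDl mulr_suml; congr (_ + _).
    by apply: eq_bigr => s _; rewrite mulrA.
  under [X in _ = X + _]eq_bigr do rewrite mulrDr mulrA.
  rewrite big_split/= -mulr_suml.
  set a := \sum_(_ <= _ < _) _; set a' := \sum_(_ <= _ < _) _; lra.
have WW m : (m < n)%N -> flight_bound H rho n0 L W m.+1 <= W m.+1.
  move=> mn; rewrite WG// lerD2r; apply: ler_sum_nat => s /andP[s0 _].
  by rewrite ler_wpM2l//; have [] := super s m s0.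
have WI m : (m < n)%N -> (1 - k0) * W m + k0 * flight_bound H rho n0 L W m.+1
    <= W m.+1.
  move=> mn; rewrite WG// /W !mulrDr !mulr_sumr.
  rewrite addrACA -mulrDl subrK mul1r lerD2r -big_split/=.
  apply: ler_sum_nat => s /andP[s0 _].
  rewrite !(mulrCA _ (p s)) -mulrDr ler_wpM2l//.
  by have [] := super s m s0.
have k00 : 0 <= k0 <= kappa by rewrite k0k andbT; case/andP: k01 => /ltW.
have W0 : 1 <= W 0%N.
  have := @sum_drop rho 1 n isT; rewrite rho1 -/(p _) => drop.
  rewrite -lerBlDr -drop; apply: ler_sum_nat => s /andP[s0 _].
  by apply: ler_wpM2l; [exact: p0|rewrite /poly_kernel leq0n s0].
have wW := remaining_le kap0 k1 H0 k00 W0 WW WI (leqnn n).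
rewrite (le_trans wW)// /W (@big_cat_nat _ _ _ k.+1)//=; last by clear -kn; lia.
rewrite -addrA addrC lerD//.
  have drop : \sum_(k.+1 <= s < n.+1) p s = rho k.+1 - rho n.+1.
    rewrite -[RHS]opprB -(@telescope_sumr _ k.+1 n.+1 rho); last by clear -kn; lia.
    by rewrite -sumrN; apply: eq_bigr => s _; rewrite opprB.
  rewrite -lerBrDr -drop; apply: ler_sum_nat => s _.
  by rewrite ler_piMr// poly_kernel_le1.
rewrite mulrAC.
apply: (@le_trans _ _ (A * (n - k - n0)%:R `^ (- b) *
    \sum_(1 <= s < k.+1) p s * s%:R)); last first.
  by rewrite ler_wpM2l ?sum_drop_index_le// mulr_ge0// powR_ge0.
rewrite mulr_sumr; apply: ler_sum_nat => s /andP[s0 sk].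
rewrite mulrCA ler_wpM2l// (le_trans (poly_kernel_le _ _ _))//; first by clear -kn sk; lia.
rewrite mulrAC ler_wpM2r// ler_wpM2l// powRN_noninc//; clear -kn sk; lia.
Qed.

End polynomial_tail.

(** * Stretched exponential tails *)

Section exponential_tail.
Local Open Scope ring_scope.
Context (R : realType).
Implicit Types (a b : R).

(** Each k <= m + n has k^b >= (k / (m + n)) (m + n)^b, because t^b >= t for t in (0, 1]; add this
    for k = m and k = n. *)
Lemma powR_subadditive b (m n : nat) : 0 < b <= 1 ->
  (m + n)%:R `^ b <= m%:R `^ b + n%:R `^ b :> R.
Proof.
move=> /andP[b0 b1].
have [->|mp] := posnP m; first by rewrite add0n lerDr powR_ge0.
have [->|np] := posnP n; first by rewrite addn0 lerDl powR_ge0.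
have sp : 0 < (m + n)%:R :> R by rewrite ltr0n addn_gt0 mp.
have part (k : nat) : (0 < k <= m + n)%N ->
    k%:R / (m + n)%:R * (m + n)%:R `^ b <= k%:R `^ b :> R.
  move=> /andP[k0 kmn]; have kp : 0 < k%:R :> R by rewrite ltr0n.
  have {2}-> : k%:R = k%:R / (m + n)%:R * (m + n)%:R :> R by rewrite divfK// gt_eqF.
  rewrite [leRHS]powRM ?divr_ge0 ?ler0n//.
  rewrite ler_wpM2r ?powR_ge0// ger1_powR// divr_gt0//=.
  by rewrite ler_pdivrMr// mul1r ler_nat.
apply: le_trans (lerD (part m _) (part n _)); rewrite ?mp ?np ?leq_addr ?leq_addl//.
by rewrite -mulrDl -mulrDl -natrD divff ?mul1r// gt_eqF.
Qed.

(** One term of the exponential series, of degree N + 1 with b (N + 1) >= 2, already dominates a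
    multiple of k^2. *)
Lemma sum_expR_powR_tail a b : 0 < a -> 0 < b -> forall e : R, 0 < e ->
  exists2 I, (0 < I)%N &
  forall M, \sum_(I <= k < M) expR (- (a * k%:R `^ b)) <= e.
Proof.
move=> a0 b0 e e0; pose N := Num.bound (2 / b).
have Nb : 2 <= b * N.+1%:R.
  rewrite mulrC -ler_pdivrMr// ltW// (lt_le_trans (archi_boundP _))//.
    by rewrite divr_ge0// ltW.
  by rewrite ler_nat.
pose c : R := a ^+ N.+1 / N.+1`!%:R.
have c0 : 0 < c by rewrite divr_gt0 ?exprn_gt0// ltr0n fact_gt0.
have lt12 : 1 < 2 :> R by lra.
have [I I0 HI] := sum_powRN_tail lt12 (mulr_gt0 e0 c0).
exists I => // M; apply: (@le_trans _ _ (c^-1 * \sum_(I <= k < M) k%:R `^ (- 2))).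
  rewrite mulr_sumr; apply: ler_sum_nat => k /andP[Ik _].
  have kp : 1 <= k%:R :> R by rewrite ler1n; clear -Ik I0; lia.
  have k0 : 0 < k%:R :> R by rewrite (lt_le_trans _ kp).
  rewrite expRN powRN -invfM lef_pV2 ?posrE ?expR_gt0 ?(mulr_gt0 c0) ?powR_gt0//.
  have x0 : 0 <= a * k%:R `^ b by rewrite mulr_ge0 ?powR_ge0// ltW.
  rewrite (le_trans _ (expR_ge1Dxn N x0))// ler_wpDl//.
  rewrite exprMn [leRHS]mulrAC -/c ler_wpM2l ?(ltW c0)//.
  rewrite -powR_mulrn ?powR_ge0// -powRrM.
  exact: ler_powR.
by rewrite ler_pdivrMl// mulrC.
Qed.

Lemma expR_le_inv (x : R) : x < 1 -> expR x <= (1 - x)^-1.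
Proof.
move=> x1; rewrite -[expR x]invrK -expRN lef_pV2 ?posrE ?expR_gt0 ?subr_gt0//.
exact: expR_ge1Dx.
Qed.

(** The supersolution is min(1, A exp(-c n^b)). By subadditivity, going back over a flight of k
    steps raises the exponential by at most exp(c (k^b + n0^b)). For k < I this factor is at most
    4/3; for longer flights its growth uses up half of the decay of [H], and what is left has a
    small sum beyond I. *)
Lemma remaining_exp_le (b Cr a CH k0 : R) (n0 : nat) :
  0 < b <= 1 -> 0 <= Cr -> 0 < a -> 0 <= CH -> 0 < k0 <= 1 ->
  exists A c, [/\ 0 < A, 0 < c & forall kappa H rho L, k0 <= kappa <= 1 ->
    (forall k, 0 <= H k) ->
    (forall k, H k <= CH * expR (- (a * k%:R `^ b))) ->
    (forall q, \sum_(0 <= u < q - L) H (q - u).+1 <= 8^-1) ->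
    (forall k, 0 <= rho k <= 1) ->
    (forall k, rho k <= Cr * expR (- (a * k%:R `^ b))) ->
    forall n, remaining kappa H rho n0 L n <= A * expR (- (c * n%:R `^ b))].
Proof.
move=> b01 Cr0 a0 CH0 /andP[k00 k01]; have [b0 b1] := andP b01.
pose phi (n : nat) : R := n%:R `^ b; have phi0 n : 0 <= phi n by exact: powR_ge0.
have phiD m n : phi (m + n)%N <= phi m + phi n by exact: powR_subadditive.
have phi_homo m n : (m <= n)%N -> phi m <= phi n.
  by move=> mn; rewrite ge0_ler_powR ?(ltW b0) ?nnegrE ?ler0n ?ler_nat.
have e0 : 0 < (32 * (CH + 1))^-1 by rewrite invr_gt0 mulr_gt0// ltr_wpDl.
have a20 : 0 < a / 2 by rewrite divr_gt0.
have [I I0 HI] := sum_expR_powR_tail a20 b0 e0.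
(* By a / 2 a flight keeps half of its decay, by k0 / 2 a single step loses little, and by the last
   term the growth over I and n0 together is at most exp(1/4) <= 4/3. *)
pose c := Num.min (Num.min (a / 2) (k0 / 2)) (4 * (phi I + phi n0 + 1))^-1.
have c0 : 0 < c.
  by rewrite /c !lt_min a20 divr_gt0//= invr_gt0 mulr_gt0// ltr_wpDl// addr_ge0.
have ca : c <= a / 2 by rewrite /c !ge_min lexx.
have ck : c <= k0 / 2 by rewrite /c !ge_min lexx orbT.
have cI : c * (phi I + phi n0) <= 4^-1.
  have : c * (4 * (phi I + phi n0 + 1)) <= 1.
    by rewrite -ler_pdivlMr ?mul1r ?ge_min ?lexx ?orbT// mulr_gt0// ltr_wpDl// addr_ge0.
  move: c0; lra.
(* The [rho] term then takes at most a quarter of the exponential; exp(a n0^b) makes up for its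
   delay n0. *)
pose A := 1 + 4 * (Cr * expR (a * phi n0)).
have A1 : 1 <= A by rewrite lerDl !mulr_ge0// expR_ge0.
have A0 : 0 < A by rewrite (lt_le_trans _ A1).
exists A, c; split => // kappa H rho L /andP[k0k k1] H0 HCH HL rho01 rhoCr n.
have rho0 k : 0 <= rho k by case/andP: (rho01 k).
pose V n := A * expR (- (c * phi n)); have V0 m : 0 < V m by rewrite mulr_gt0 ?expR_gt0.
pose W n := Num.min 1 (V n).
have W0 m : 0 <= W m by rewrite le_min ler01 ltW.
have WV m : W m <= V m by rewrite ge_min lexx orbT.
have W1 m : W m <= 1 by rewrite ge_min lexx.
suff : remaining kappa H rho n0 L n <= W n by move/le_trans; apply; exact: WV.
have sumH q : 0 <= \sum_(0 <= u < q - L) H (q - u).+1 by exact: sumr_ge0.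
have G1 m : flight_bound H rho n0 L W m.+1 <= 1.
  rewrite /flight_bound; set q := (m.+1 - n0)%N.
  have := HL q; have := sumH q; set S := \sum_(_ <= _ < _) H _ => S0 S8.
  have : \sum_(0 <= u < q - L) W u * H (q - u).+1 <= S.
    by apply: ler_sum => u _; rewrite ler_piMl.
  case/andP: (rho01 q.+1) => r0 r1.
  have : 0 <= (1 - rho q.+1) * (1 - S) by rewrite mulr_ge0 ?subr_ge0//; lra.
  lra.
have GV m : flight_bound H rho n0 L W m.+1 <= V m.+1 / 2.
  rewrite /flight_bound; set q := (m.+1 - n0)%N.
  have h1 : rho q.+1 * (1 - \sum_(0 <= u < q - L) H (q - u).+1) <= V m.+1 / 4.
    apply: (@le_trans _ _ (rho q.+1)); first by rewrite ler_piMr// gerBl.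
    apply: (@le_trans _ _ (Cr * (expR (a * phi n0) * expR (- (c * phi m.+1))))).
      rewrite (le_trans (rhoCr _))// ler_wpM2l// -expRD ler_expR -/(phi _).
      have : phi m.+1 <= phi q.+1 + phi n0.
        by rewrite (le_trans _ (phiD _ _))// phi_homo// /q; clear; lia.
      have := phi0 m.+1.
      have : 0 <= (a / 2 - c) * phi m.+1 by rewrite mulr_ge0// subr_ge0.
      move=> h ph /(ler_wpM2l (ltW a0)); nra.
    rewrite /V /A; have := expR_ge0 (- (c * phi m.+1)).
    by set x := expR _; lra.
  have h2 : \sum_(0 <= u < q - L) W u * H (q - u).+1 <= V m.+1 / 4.
    pose F k := if (I <= k)%N then expR (- (a / 2 * phi k)) else 0.
    have F0 k : 0 <= F k by rewrite /F; case: ifP => // _; exact: expR_ge0.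
    apply: (@le_trans _ _ (V m.+1 * (4 / 3) * (\sum_(0 <= u < q - L) H (q - u).+1
        + CH * \sum_(0 <= u < q - L) F (q - u).+1))).
      rewrite [X in _ + X]mulr_sumr -big_split/= mulr_sumr; apply: ler_sum_nat => u /andP[_ uq].
      set k := (q - u).+1.
      have Wu : W u <= V m.+1 * expR (c * (phi k + phi n0)).
        rewrite (le_trans (WV _))// /V -mulrA ler_wpM2l ?(ltW A0)// -expRD ler_expR.
        rewrite -lerN2 opprK opprD opprK -mulrN -mulrDr ler_wpM2l ?(ltW c0)//.
        rewrite lerBlDr.
        have := phiD u (k + n0)%N; have := phiD k n0.
        have : phi m.+1 <= phi (u + (k + n0))%N.
          by apply: phi_homo; rewrite /k /q; clear; lia.
        lra.
      apply: (le_trans (ler_wpM2r (H0 _) Wu)).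
      rewrite -[V m.+1 * _ * H k]mulrA -[V m.+1 * _ * _]mulrA.
      apply: ler_wpM2l; first exact/ltW.
      have e4 (x : R) : x <= 4^-1 -> expR x <= 4 / 3.
        move=> x4; apply: (le_trans (expR_le_inv _)); first lra.
        have -> : 4 / 3 = (3 / 4)^-1 :> R by rewrite invf_div.
        by rewrite lef_pV2 ?posrE; clear -x4; lra.
      have [kI|Ik] := ltnP k I.
        rewrite /F leqNgt kI/= mulr0 addr0 ler_wpM2r// e4// (le_trans _ cI)//.
        by rewrite ler_wpM2l ?(ltW c0)// lerD2r phi_homo// ltnW.
      rewrite /F Ik [leRHS]mulrDr; apply: ler_wpDl; first by rewrite mulr_ge0.
      rewrite mulrDr addrC expRD -mulrA.
      apply: ler_pM; rewrite ?mulr_ge0 ?expR_ge0//.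
        by apply: e4; rewrite (le_trans _ cI)// ler_wpM2l ?(ltW c0)// lerDr.
      apply: (le_trans (ler_wpM2l (expR_ge0 _) (HCH _))).
      rewrite mulrCA ler_wpM2l// -expRD ler_expR.
      rewrite -/(phi k).
      have : 0 <= (a / 2 - c) * phi k by rewrite mulr_ge0// subr_ge0.
      lra.
    have hF : \sum_(0 <= u < q - L) F (q - u).+1 <= (32 * (CH + 1))^-1.
      rewrite sum_flights; last by clear; lia.
      apply: (@le_trans _ _ (\sum_(0 <= k < maxn I q.+2) F k)).
        rewrite [leRHS](@big_cat_nat _ _ _ (q.+2 - (q - L)))//=; last by clear; lia.
        rewrite ler_wpDl ?sumr_ge0//.
        rewrite [leRHS](@big_cat_nat _ _ _ q.+2)//=; [|by clear; lia|by clear; lia].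
        by rewrite lerDl sumr_ge0.
      rewrite (@big_cat_nat _ _ _ I)//=; last by clear; lia.
      rewrite big_nat_cond big1 ?add0r; last first.
        by move=> k /andP[/andP[_ kI] _]; rewrite /F leqNgt kI.
      rewrite (le_trans _ (HI (maxn I q.+2)))//.
      by apply: ler_sum_nat => k /andP[Ik _]; rewrite /F Ik.
    have CHe : CH * (32 * (CH + 1))^-1 <= 32^-1.
      by rewrite ler_pdivrMr ?mulr_gt0 ?ltr_wpDl//; clear -CH0; lra.
    have := HL q; set S1 := \sum_(_ <= _ < _) H _; set S2 := \sum_(_ <= _ < _) F _ in hF * => S8.
    have h3 : S1 + CH * S2 <= 3 / 16.
      have := ler_wpM2l CH0 hF; lra.
    have := ler_wpM2l (ltW (V0 m.+1)) h3; lra.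
  lra.
have k00k : 0 <= k0 <= kappa by rewrite (ltW k00).
have kap0 : 0 <= kappa by rewrite (le_trans _ k0k)// ltW.
apply: (remaining_le kap0 k1 H0 k00k _ _ _ (leqnn n)).
- rewrite /W le_min lexx/= /V /phi powR0 ?gt_eqF// mulr0 oppr0 expR0 mulr1//.
- move=> m _; rewrite /W le_min G1/= (le_trans (GV m))//.
  by rewrite ler_pdivrMr// ler_peMr ?ler1n// ltW.
- move=> m _; rewrite {2}/W le_min; apply/andP; split.
    have : 0 <= (1 - k0) * (1 - W m) by rewrite mulr_ge0 ?subr_ge0.
    have := ler_wpM2l (ltW k00) (G1 m); lra.
  apply: (@half_contraction _ k0 c (V m)) => //; first by rewrite k00.
  - by rewrite (ltW c0).
  - exact: ltW.
  have c1 : c < 1 by rewrite (le_lt_trans ck)//; clear -k01; lra.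
  rewrite -ler_pdivlMr ?subr_gt0// /V -mulrA ler_wpM2l ?(ltW A0)//.
  apply: (@le_trans _ _ (expR (- (c * phi m.+1)) * expR c)); last first.
    by rewrite ler_wpM2l ?expR_ge0// expR_le_inv.
  rewrite -expRD ler_expR -lerN2 opprD !opprK -[X in _ - X]mulr1 -mulrBr.
  rewrite ler_wpM2l ?(ltW c0)// lerBlDr.
  by have := phiD m 1%N; rewrite addn1 {3}/phi powR1.
Qed.

End exponential_tail.

(** * The prescribed masses *)

Section prescribed_masses.
Local Open Scope ring_scope.
Context (R : realType).
Implicit Types (c : constants R) (h r : nat -> R).

(** The tail masses of a probability measure are nonincreasing and at most 1, so r may be replaced
    by its running minimum with 1. Monotonicity makes the weights r(s) - r(s+1) nonnegative. *)
Fixpoint running_min r (n : nat) : R :=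
  if n is k.+1 then Num.min (running_min r k) (r n) else Num.min 1 (r 0%N).

(** The largest ratio between a K2-log-Lipschitz density on Y and its mass. *)
Definition distortion c : R := expR (cK2 c * cdiam c).

Definition flight_tail c h (k : nat) : R := distortion c * h k.

Definition short_flights c h (L : nat) : Prop :=
  forall M, \sum_(L <= k < M) flight_tail c h k <= 8^-1.

(** The least length is taken so that any length read off from a bound on h dominates it. *)
Definition lag c h : nat :=
  get [set L | short_flights c h L /\
               forall L', short_flights c h L' -> (L <= L')%N].

(** The exponential bounds a K1-log-Lipschitz density below by its mass. The factor 1/2 limits a
    removal to half of the mass, and 1 - K1/K2 keeps the rest K2-log-Lipschitz. *)
Definition extractable c : R :=
  expR (- (cK1 c * cdiam c)) * Num.min 2^-1 (1 - cK1 c / cK2 c).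

(* At most half of the mass in Y is split off at each of the n0 + L steps from a
   visit in the window to time n, whence the power of 1/2. *)
Definition return_rate c (L : nat) : R :=
  2^-1 ^+ (cn0 c + L) * (distortion c)^-1 * cdelta0 c / L.+1%:R.

Definition rate c (L : nat) : R := extractable c * return_rate c L.

Definition left_mass c h r (n : nat) : R :=
  remaining (rate c (lag c h)) (flight_tail c h) (running_min r)
    (cn0 c) (lag c h) n.

Definition alpha c h r (n : nat) : R := left_mass c h r n.-1 - left_mass c h r n.

(** What the tail estimates use of a system, stated without it: the constants C must be chosen
    before the system is given. *)
Record admissible_constants c : Prop := {
  adm_K1 : 0 < cK1 c;
  adm_K12 : cK1 c < cK2 c;
  adm_diam : 0 <= cdiam c;
  adm_n0 : (1 <= cn0 c)%N;
  adm_delta0 : 0 < cdelta0 c <= 1 }.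

(** As to [adm_r_ge1]: for n <= 1 the tail set is the whole space, so every tail bound is at least 1
    there. *)
Record admissible_tails c h r : Prop := {
  adm_h0 : forall n, 0 <= h n;
  adm_hK : forall M, \sum_(1 <= k < M) h k <= cK c;
  adm_r0 : forall n, 0 <= r n;
  adm_r_small : forall e, 0 < e -> exists n, r n < e;
  adm_r_ge1 : 1 <= r 0%N /\ 1 <= r 1%N }.

Lemma running_min_le r n : running_min r n <= r n.
Proof. by case: n => [|n] /=; rewrite ge_min lexx orbT. Qed.

Lemma running_minS r n : running_min r n.+1 <= running_min r n.
Proof. by rewrite /= ge_min lexx. Qed.

Lemma running_min_homo r m n : (m <= n)%N -> running_min r n <= running_min r m.
Proof.
elim: n => [|n IH]; first by rewrite leqn0 => /eqP ->.
rewrite leq_eqVlt => /orP[/eqP -> //|]; rewrite ltnS => /IH.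
exact/le_trans/running_minS.
Qed.

Lemma running_min_ge r x n : x <= 1 -> (forall k, (k <= n)%N -> x <= r k) ->
  x <= running_min r n.
Proof.
move=> x1; elim: n => [|n IH] xr; first by rewrite /= le_min x1 xr.
by rewrite /= le_min xr// IH// => k kn; apply: xr; rewrite (leq_trans kn).
Qed.

Lemma running_min01 r n : (forall k, 0 <= r k) -> 0 <= running_min r n <= 1.
Proof.
move=> r0; rewrite running_min_ge//= (le_trans (running_min_homo r (leq0n n)))//.
by rewrite /= ge_min lexx.
Qed.

Lemma bounded_series_tail (u : nat -> R) (m : nat) (B : R) :
  (forall k, 0 <= u k) -> (forall M, \sum_(m <= k < M) u k <= B) ->
  forall e, 0 < e -> exists2 L, (m <= L)%N & forall M, \sum_(L <= k < M) u k < e.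
Proof.
move=> u0 uB e e0; pose A := range (fun M => \sum_(m <= k < M) u k).
have hA : has_sup A by split; [exists (\sum_(m <= k < 0) u k); exists 0%N|exists B => _ [M _ <-]].
have [_ [L _ <-] supL] := sup_adherent e0 hA.
exists (maxn m L) => [|M]; first exact: leq_maxl.
have {}supL : sup A - e < \sum_(m <= k < maxn m L) u k.
  rewrite (lt_le_trans supL)//; have [Lm|/ltnW mL] := leqP L m.
    by rewrite !big_geq.
  by [].
have [ML|LM] := leqP M (maxn m L); first by rewrite big_geq.
have : \sum_(m <= k < M) u k <= sup A.
  by apply: ub_le_sup; [exact: hA.2|exists M].
rewrite (@big_cat_nat _ _ _ (maxn m L))/= ?leq_maxl ?(ltnW LM)//.
move: supL; lra.
Qed.

Lemma flight_tail_ge0 c h : (forall n, 0 <= h n) -> forall k, 0 <= flight_tail c h k.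
Proof. by move=> h0 k; rewrite mulr_ge0// expR_ge0. Qed.

Lemma flight_tail_small c h r : admissible_tails c h r ->
  forall e, 0 < e -> exists L, forall M, \sum_(L <= k < M) flight_tail c h k < e.
Proof.
case=> h0 hK _ _ _ e e0.
have d0 : 0 < distortion c by exact: expR_gt0.
have [L _ HL] := bounded_series_tail h0 hK (divr_gt0 e0 d0).
by exists L => M; rewrite -mulr_sumr mulrC -ltr_pdivlMr.
Qed.

Lemma lagP c h L : short_flights c h L ->
  short_flights c h (lag c h) /\ (lag c h <= L)%N.
Proof.
move=> hL; have [L1 /asboolP hL1 minL1] : exists2 L1, `[< short_flights c h L1 >]
    & forall L', short_flights c h L' -> (L1 <= L')%N.
  have ex : exists L, `[< short_flights c h L >] by exists L; exact/asboolP.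
  by exists (ex_minn ex); case: ex_minnP => // L1 _ mL1 L' hL'; apply/mL1/asboolP.
have [] : [set L | short_flights c h L /\
    forall L', short_flights c h L' -> (L <= L')%N] (lag c h).
  by apply: (@getPex _ [set L | _ /\ _]); exists L1.
by move=> h1 h2; split => //; exact: h2.
Qed.

Lemma short_flights_lag c h r : admissible_tails c h r ->
  short_flights c h (lag c h).
Proof.
move=> adm; have e0 : 0 < 8^-1 :> R by [].
have [L HL] := flight_tail_small adm e0.
by have [|] := @lagP c h L; first by move=> M; exact/ltW.
Qed.

Lemma short_flights_sum c h L : (forall n, 0 <= h n) -> short_flights c h L ->
  forall q, \sum_(0 <= u < q - L) flight_tail c h (q - u).+1 <= 8^-1.
Proof.
move=> h0 sL q; rewrite sum_flights; last by clear; lia.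
have [Lq|/ltnW/eqP ->] := leqP L q; last by rewrite subn0 big_geq.
apply: le_trans (sL q.+2).
rewrite [leRHS](@big_cat_nat _ _ _ (q.+2 - (q - L)))/=; [|by clear -Lq; lia|by clear; lia].
by rewrite lerDr sumr_ge0// => k _; exact: flight_tail_ge0.
Qed.

Lemma extractable_gt0 c : admissible_constants c -> 0 < extractable c <= 2^-1.
Proof.
case=> K1 K12 D0 _ _; have K2 : 0 < cK2 c by rewrite (lt_trans K1).
have a0 : 0 < Num.min 2^-1 (1 - cK1 c / cK2 c).
  by rewrite lt_min invr_gt0 ltr0n/= subr_gt0 ltr_pdivrMr// mul1r.
rewrite mulr_gt0 ?expR_gt0//=.
apply: (@le_trans _ _ (Num.min 2^-1 (1 - cK1 c / cK2 c))).
  by rewrite ler_piMl ?(ltW a0)// expR_le1 oppr_le0 mulr_ge0// ltW.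
by rewrite ge_min lexx.
Qed.

Lemma return_rate_gt0 c L : admissible_constants c -> 0 < return_rate c L <= 1.
Proof.
case=> K1 K12 D0 _ /andP[d0 d1]; have K2 : 0 < cK2 c by rewrite (lt_trans K1).
have v0 : 0 < (distortion c)^-1 by rewrite invr_gt0 expR_gt0.
have p0 : 0 < 2^-1 ^+ (cn0 c + L) :> R by rewrite exprn_gt0// invr_gt0.
have v1 : (distortion c)^-1 <= 1.
  by rewrite invf_le1 ?expR_gt0// -expR0 ler_expR mulr_ge0// ltW.
have p1 : 2^-1 ^+ (cn0 c + L) <= 1 :> R.
  by rewrite exprn_ile1 ?invr_ge0// invf_le1// ler1n.
have l0 : 0 < L.+1%:R^-1 :> R by rewrite invr_gt0 ltr0n.
apply/andP; split; first by do 3 apply: mulr_gt0 => //.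
rewrite /return_rate ler_pdivrMr ?ltr0n// mul1r.
apply: (@le_trans _ _ 1); last by rewrite ler1n.
by rewrite mulr_ile1 ?mulr_ge0 ?mulr_ile1// ltW.
Qed.

Lemma rate_gt0 c L : admissible_constants c -> 0 < rate c L <= 1.
Proof.
move=> adm; have /andP[a0 a1] := extractable_gt0 adm.
have /andP[b0 b1] := return_rate_gt0 L adm.
rewrite mulr_gt0//= mulr_ile1 ?(ltW a0) ?(ltW b0)// (le_trans a1)//.
by rewrite invf_le1// ler1n.
Qed.

Lemma rate_noninc c L L' : admissible_constants c -> (L <= L')%N ->
  rate c L' <= rate c L.
Proof.
move=> adm LL'; have /andP[a0 _] := extractable_gt0 adm.
rewrite ler_wpM2l ?(ltW a0)// /return_rate.
case: adm => _ _ _ _ /andP[/ltW d0 _].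
have v0 : 0 <= (distortion c)^-1 by rewrite invr_ge0 expR_ge0.
have p0 n : 0 <= 2^-1 ^+ n :> R by rewrite exprn_ge0// invr_ge0.
apply: ler_pM; [by rewrite !mulr_ge0|by rewrite invr_ge0| |]; last first.
  by rewrite lef_pV2 ?posrE// ler_nat.
do 2 apply: ler_wpM2r => //; apply: ler_wiXn2l; rewrite ?invr_ge0 ?leq_add2l//.
by rewrite invf_le1// ler1n.
Qed.

Section admissible.
Variables (c : constants R) (h r : nat -> R).
Hypotheses (admc : admissible_constants c) (adm : admissible_tails c h r).
Let L := lag c h.
Let k0 : 0 <= rate c L. Proof. by have /andP[/ltW] := rate_gt0 L admc. Qed.
Let k1 : rate c L <= 1. Proof. by have /andP[] := rate_gt0 L admc. Qed.
Let H0 := flight_tail_ge0 c (adm_h0 adm).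
Let HL := short_flights_sum (adm_h0 adm) (short_flights_lag adm).
Let rho0 n : 0 <= running_min r n.
Proof. by have /andP[] := running_min01 n (adm_r0 adm). Qed.

Lemma running_min1 : running_min r 1 = 1.
Proof.
case: (adm_r_ge1 adm) => r0 r1; apply/le_anti.
by have /andP[_ ->] := running_min01 1 (adm_r0 adm); rewrite running_min_ge// => -[|[]].
Qed.

Lemma left_mass_ge0 n : 0 <= left_mass c h r n.
Proof. exact: remaining_ge0. Qed.

Lemma left_mass_le1 n : left_mass c h r n <= 1.
Proof. exact: remaining_le1. Qed.

Lemma left_mass_noninc m n : (m <= n)%N -> left_mass c h r n <= left_mass c h r m.
Proof. by move=> mn; exact: remaining_homo. Qed.

Lemma alpha_ge0 n : 0 <= alpha c h r n.
Proof. by rewrite subr_ge0 left_mass_noninc// leq_pred. Qed.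

Lemma alphaS n : alpha c h r n.+1 = rate c L * Num.max 0 (left_mass c h r n -
  flight_bound (flight_tail c h) (running_min r) (cn0 c) L (left_mass c h r) n.+1).
Proof. by rewrite /alpha /left_mass remainingS opprB addrCA subrr addr0. Qed.

Lemma left_mass_cvg0 : left_mass c h r n @[n --> \oo] --> (0 : R).
Proof.
apply/cvgrPdist_lt => e e0.
have kp : 0 < rate c L by have /andP[] := rate_gt0 L admc.
have rhoV e' : 0 < e' -> exists n, forall k, (n <= k)%N -> running_min r k < e'.
  move=> /(adm_r_small adm)[n rn]; exists n => k nk.
  by rewrite (le_lt_trans (running_min_homo _ nk))// (le_lt_trans (running_min_le _ _)).
have [n wn] := remaining_arbitrarily_small (cn0 c) k0 k1 H0 rho0 HL kp rhoV
  (flight_tail_small adm) e0.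
exists n => // m /= nm; rewrite sub0r normrN ger0_norm ?left_mass_ge0//.
by rewrite (le_lt_trans (left_mass_noninc nm)).
Qed.

Lemma series_alpha n : (1 <= n)%N ->
  (\sum_(n <= j <oo) (alpha c h r j)%:E = (left_mass c h r n.-1)%:E)%E.
Proof.
move=> n1; apply/cvg_lim => //.
have : (left_mass c h r n.-1 - left_mass c h r M)%:E @[M --> \oo]
    --> ((left_mass c h r n.-1)%:E : \bar R).
  apply: cvg_EFin; first exact: nearW.
  rewrite -[X in _ --> X]subr0; apply: cvgB; [exact: cvg_cst|exact: left_mass_cvg0].
move=> cv; rewrite -(cvg_shiftn 1).
apply: cvg_trans cv; apply: near_eq_cvg; near=> M.
have nM : (n <= M + 1)%N by rewrite addn1 leqW//; near: M; exact: nbhs_infty_ge.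
rewrite /= sumEFin; congr EFin.
have := @telescope_sumr _ n (M + 1) (fun j => - left_mass c h r j.-1) nM.
rewrite opprK addn1/= addrC => <-.
by apply: eq_bigr => j _; rewrite /alpha opprK addrC.
Unshelve. all: by end_near. Qed.

End admissible.

(** A belongs to the rate at a length L0 computed from [Cb]. For every h under that bound the lag is
    at most L0 and its rate at least that one, so A does not depend on h. *)
Lemma left_mass_poly_le c (Cb b : R) : admissible_constants c -> 1 < b ->
  exists2 A, 1 <= A & forall h r, admissible_tails c h r ->
    (forall n, (1 <= n)%N -> h n <= Cb * n%:R `^ (- b)) ->
    forall n k, (k + cn0 c < n)%N -> left_mass c h r n <= running_min r k.+1
      + A * (\sum_(1 <= s < k.+1) running_min r s) * (n - k - cn0 c)%:R `^ (- b).
Proof.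
(* The sign of [Cb] is unknown before h is given, hence the absolute value. *)
move=> admc b1; pose CH := distortion c * `|Cb|.
have d0 : 0 < distortion c by exact: expR_gt0.
have CH0 : 0 <= CH by rewrite mulr_ge0// ltW.
have e0 : 0 < (8 * (CH + 1))^-1 by rewrite invr_gt0 mulr_gt0// ltr_wpDl.
have [L0 L00 HL0] := sum_powRN_tail b1 e0.
have [A A1 HA] := remaining_poly_le (cn0 c) b1 CH0 (rate_gt0 L0 admc).
exists A => // h r adm hCb n k kn.
have HCH j : (0 < j)%N -> flight_tail c h j <= CH * j%:R `^ (- b).
  move=> j0; rewrite /CH -mulrA ler_wpM2l ?(ltW d0)//.
  by rewrite (le_trans (hCb _ j0))// ler_wpM2r ?powR_ge0// ler_norm.
have sL0 : short_flights c h L0.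
  move=> M; apply: (@le_trans _ _ (CH * \sum_(L0 <= j < M) j%:R `^ (- b))).
    rewrite mulr_sumr; apply: ler_sum_nat => j /andP[L0j _].
    by apply: HCH; rewrite (leq_trans L00).
  rewrite (le_trans (ler_wpM2l CH0 (HL0 M)))//.
  by rewrite ler_pdivrMr ?mulr_gt0 ?ltr_wpDl//; clear -CH0; lra.
have [sL LL0] := lagP sL0.
apply: HA => //.
- by rewrite rate_noninc//=; have /andP[] := rate_gt0 (lag c h) admc.
- exact/flight_tail_ge0/(adm_h0 adm).
- exact/short_flights_sum/sL/(adm_h0 adm).
- by move=> j; have /andP[] := running_min01 j (adm_r0 adm).
- exact: running_minS.
- exact: running_min1 adm.
Qed.

(** It replaces the sum of s^-b', which may diverge, by the convergent sum of s^-b, at the price of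
    n^-b' in place of n^-b. *)
Lemma powRN_swap (b b' : R) (s n : nat) : b' <= b -> (0 < s <= n)%N ->
  s%:R `^ (- b') * n%:R `^ (- b) <= n%:R `^ (- b') * s%:R `^ (- b).
Proof.
move=> b'b sn; have /andP[s0 _] := sn.
have n0 : (0 < n)%N by clear -sn; lia.
have split (i : nat) : (0 < i)%N ->
    i%:R `^ (- b) = i%:R `^ (- b') * i%:R `^ (- (b - b')) :> R.
  move=> i0; have i0' : i%:R != 0 :> R by rewrite pnatr_eq0 -lt0n.
  by rewrite -powRD ?i0' ?implybT//; congr (_ `^ _); lra.
rewrite (split n n0) (split s s0) mulrA [leRHS]mulrA [_ `^ (- b') * _]mulrC.
by rewrite ler_wpM2l ?mulr_ge0 ?powR_ge0// powRN_noninc// subr_ge0.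
Qed.

Lemma left_mass_tail1 c (Cb b b' : R) : admissible_constants c -> 1 < b ->
  0 < b' -> b' <= b ->
  exists C, forall h r (Cb' : R), admissible_tails c h r ->
    (forall n, (1 <= n)%N -> h n <= Cb * n%:R `^ (- b)) ->
    (forall n, (1 <= n)%N -> r n <= Cb' * n%:R `^ (- b')) ->
    forall n, (1 <= n)%N -> left_mass c h r n.-1 <= C * Cb' * n%:R `^ (- b').
Proof.
move=> admc b1 b'0 b'b; have [A A1 HA] := left_mass_poly_le Cb admc b1.
have [Z Z0 HZ] := sum_powRN_bounded b1.
have b0 : 0 <= b by rewrite ltW// (lt_trans _ b1).
have A0 : 0 <= A by rewrite (le_trans _ A1).
pose N := (4 * cn0 c + 3)%N.
(* With k = n/2 - n0, the three terms pay for n < N, where the mass is bounded by 1; for r at k + 1,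
   where n <= 4 (k + 1); and for the kernels, where n <= 6 (n - 1 - k - n0). *)
pose C := N%:R `^ b' + (4 `^ b' + A * Z * 6 `^ b).
have C4 : 0 <= 4 `^ b' + A * Z * 6 `^ b.
  by rewrite addr_ge0 ?mulr_ge0 ?powR_ge0// ltW.
exists C => h r Cb' adm hCb rCb n n1.
(* This lets [Cb'] be a factor of the trivial bound for small n. *)
have Cb1 : 1 <= Cb'.
  have := rCb 1%N isT; rewrite powR1 mulr1; apply: le_trans.
  by case: (adm_r_ge1 adm).
have Cb0 : 0 <= Cb' by rewrite (le_trans _ Cb1).
have np : 0 <= n%:R `^ (- b') :> R by exact: powR_ge0.
have [nN|Nn] := ltnP n N.
  apply: (@le_trans _ _ 1); first exact: left_mass_le1.
  apply: (@le_trans _ _ (N%:R `^ b' * 1 * n%:R `^ (- b'))).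
    rewrite mulr1 powRN ler_pdivlMr ?powR_gt0 ?ltr0n// mul1r.
    by rewrite ge0_ler_powR ?(ltW b'0) ?nnegrE ?ler0n// ler_nat ltnW.
  rewrite ler_wpM2r// ler_pM ?powR_ge0// lerDl//.
pose k := (n./2 - cn0 c)%N.
have n2 := odd_double_half n.
have kn : (k + cn0 c < n.-1)%N by rewrite /k; clear -Nn n2; rewrite /N in Nn; lia.
rewrite (le_trans (HA h r adm hCb _ _ kn))//.
apply: (@le_trans _ _ ((4 `^ b' + A * Z * 6 `^ b) * Cb' * n%:R `^ (- b'))); last first.
  by rewrite ler_wpM2r// ler_wpM2r// lerDr powR_ge0.
rewrite !mulrDl lerD//.
  rewrite (le_trans (running_min_le _ _))// (le_trans (rCb _ _))//.
  rewrite [_ * Cb']mulrC -mulrA ler_wpM2l// powRN_scale ?(ltW b'0)//.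
  by rewrite -natrM ler_nat /k; clear -Nn n2; rewrite /N in Nn; lia.
apply: (@le_trans _ _ (A * (\sum_(1 <= s < k.+1) running_min r s)
    * (6 `^ b * n%:R `^ (- b)))).
  rewrite ler_wpM2l ?mulr_ge0 ?sumr_ge0//.
    by move=> s _; have /andP[] := running_min01 s (adm_r0 adm).
  apply: powRN_scale => //.
  by rewrite -natrM ler_nat /k; clear -Nn n2; rewrite /N in Nn; lia.
have -> : A * (\sum_(1 <= s < k.+1) running_min r s) * (6 `^ b * n%:R `^ (- b))
    = A * 6 `^ b * (\sum_(1 <= s < k.+1) running_min r s * n%:R `^ (- b)).
  by rewrite -mulr_suml; ring.
have -> : A * Z * 6 `^ b * Cb' * n%:R `^ (- b')
    = A * 6 `^ b * (Cb' * n%:R `^ (- b') * Z) by ring.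
rewrite ler_wpM2l ?mulr_ge0 ?powR_ge0//.
apply: (@le_trans _ _ (Cb' * n%:R `^ (- b') * \sum_(1 <= s < k.+1) s%:R `^ (- b))).
  rewrite mulr_sumr; apply: ler_sum_nat => s /andP[s0 sk].
  rewrite (le_trans (ler_wpM2r (powR_ge0 _ _) (running_min_le _ _)))//.
  rewrite (le_trans (ler_wpM2r (powR_ge0 _ _) (rCb _ s0)))//.
  rewrite -!mulrA ler_wpM2l// powRN_swap// s0/=; clear -sk n2; rewrite /k in sk; lia.
by rewrite ler_wpM2l// mulr_ge0.
Qed.

Lemma left_mass_tail2 c (Cb b : R) : admissible_constants c -> 1 < b ->
  exists C, forall h r, admissible_tails c h r ->
    (forall n, (1 <= n)%N -> h n <= Cb * n%:R `^ (- b)) ->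
    forall n, (2 * cn0 c <= n)%N ->
    ((left_mass c h r n.-1)%:E <= (r (n./2 - cn0 c)%N)%:E
       + (C * n%:R `^ (- b))%:E * \sum_(1 <= j <oo) (r j)%:E)%E.
Proof.
move=> admc b1; have [A A1 HA] := left_mass_poly_le Cb admc b1.
have b0 : 0 <= b by rewrite ltW// (lt_trans _ b1).
have A0 : 0 <= A by rewrite (le_trans _ A1).
pose C := 2 `^ b + A * 6 `^ b.
have C0 : 0 <= C by rewrite addr_ge0 ?mulr_ge0 ?powR_ge0.
exists C => h r adm hCb n n2n0.
have n2 : (2 <= n)%N by have := adm_n0 admc; clear -n2n0; lia.
pose k := (n./2 - cn0 c)%N; rewrite -/k.
have partial_le M : ((\sum_(1 <= j < M) r j)%:E <= \sum_(1 <= j <oo) (r j)%:E)%E.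
  rewrite -sumEFin; apply: nneseries_lim_ge => j _ _.
  by rewrite lee_fin (adm_r0 adm).
(* A partial sum of r suffices, whether or not the series converges. *)
have [M HM] : exists M, left_mass c h r n.-1
    <= r k + C * n%:R `^ (- b) * \sum_(1 <= j < M) r j; last first.
  move: HM; rewrite -lee_fin EFinD EFinM => HM.
  rewrite (le_trans HM)// leeD2l// lee_wpmul2l// lee_fin mulr_ge0// powR_ge0.
have [n3|n3] := leqP 3 n.
  exists k.+1.
  have nh := odd_double_half n.
  have kn : (k + cn0 c < n.-1)%N by rewrite /k; clear -n3 nh n2n0; lia.
  rewrite (le_trans (HA h r adm hCb _ _ kn))// lerD//.
    by rewrite (le_trans (running_minS _ _))// running_min_le.
  apply: (@le_trans _ _ (A * (\sum_(1 <= s < k.+1) running_min r s)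
      * (6 `^ b * n%:R `^ (- b)))).
    rewrite ler_wpM2l ?mulr_ge0 ?sumr_ge0//.
      by move=> s _; have /andP[] := running_min01 s (adm_r0 adm).
    apply: powRN_scale => //; first by clear -n3; lia.
    by rewrite -natrM ler_nat /k; clear -n3 nh n2n0; lia.
  have -> : A * (\sum_(1 <= s < k.+1) running_min r s) * (6 `^ b * n%:R `^ (- b))
      = A * 6 `^ b * n%:R `^ (- b) * (\sum_(1 <= s < k.+1) running_min r s) by ring.
  apply: ler_pM; rewrite ?mulr_ge0 ?powR_ge0 ?sumr_ge0//.
  - by move=> s _; have /andP[] := running_min01 s (adm_r0 adm).
  - by rewrite ler_wpM2r ?powR_ge0// lerDr powR_ge0.
  - by apply: ler_sum => s _; exact: running_min_le.
(* Here n = 2, so n0 = 1 and there is no room for k + n0 < n - 1. The mass is at most 1, which 2^b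
   n^-b r(1) dominates. *)
exists 2%N; rewrite big_nat1.
have -> : n = 2%N by clear -n2 n3; lia.
rewrite (le_trans (left_mass_le1 h r admc _))// ler_wpDl ?(adm_r0 adm)//.
have [_ r1] := adm_r_ge1 adm.
rewrite -[leLHS]mulr1 ler_pM// powRN ler_pdivlMr ?powR_gt0// mul1r lerDl.
by rewrite mulr_ge0// powR_ge0.
Qed.

Lemma left_mass_tail3 c (Cb Cb' b : R) : admissible_constants c ->
  0 < b <= 1 -> 0 < Cb -> 0 < Cb' ->
  exists C C', [/\ 0 < C, 0 < C' & forall h r, admissible_tails c h r ->
    (forall n, h n <= Cb * expR (- (Cb' * n%:R `^ b))) ->
    (forall n, r n <= Cb * expR (- (Cb' * n%:R `^ b))) ->
    forall n, (1 <= n)%N ->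
      left_mass c h r n.-1 <= C * expR (- (C' * n%:R `^ b))].
Proof.
move=> admc b01 Cb0 Cb'0; have /andP[b0 b1] := b01.
pose CH := distortion c * Cb.
have d0 : 0 < distortion c by exact: expR_gt0.
have CH0 : 0 < CH by rewrite mulr_gt0.
have e0 : 0 < (8 * CH)^-1 by rewrite invr_gt0 mulr_gt0.
have [L0 L00 HL0] := sum_expR_powR_tail Cb'0 b0 e0.
have [A [a [A0 a0 HA]]] := remaining_exp_le (cn0 c) b01 (ltW Cb0) Cb'0 (ltW CH0)
  (rate_gt0 L0 admc).
(* The factor exp(a) pays for passing from n - 1 to n. *)
exists (A * expR a), a; split; rewrite ?mulr_gt0 ?expR_gt0// => h r adm hCb rCb n n1.
have HCH j : flight_tail c h j <= CH * expR (- (Cb' * j%:R `^ b)).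
  by rewrite /CH -mulrA ler_wpM2l ?(ltW d0).
have sL0 : short_flights c h L0.
  move=> M; apply: (@le_trans _ _ (CH * \sum_(L0 <= j < M) expR (- (Cb' * j%:R `^ b)))).
    by rewrite mulr_sumr; exact: ler_sum.
  rewrite (le_trans (ler_wpM2l (ltW CH0) (HL0 M)))//.
  by rewrite invfM mulrCA mulfV ?mulr1// gt_eqF.
have [sL LL0] := lagP sL0.
apply: (@le_trans _ _ (A * expR (- (a * n.-1%:R `^ b)))).
  apply: HA => //.
  - by rewrite rate_noninc//=; have /andP[] := rate_gt0 (lag c h) admc.
  - exact/flight_tail_ge0/(adm_h0 adm).
  - exact/short_flights_sum/sL/(adm_h0 adm).
  - by move=> j; exact: running_min01 (adm_r0 adm).
  - by move=> j; rewrite (le_trans (running_min_le _ _)).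
rewrite -mulrA ler_wpM2l ?(ltW A0)// -expRD ler_expR.
have := powR_subadditive n.-1 1 b01; rewrite addn1 prednK// powR1 => nb.
by have := ler_wpM2l (ltW a0) nb; lra.
Qed.

End prescribed_masses.

(** * Densities with log-Lipschitz bounds *)

Section density_measures.
Context d (T : measurableType d) (R : realType) (m : {measure set T -> \bar R}).

Lemma exists_density_measure (g : T -> R) :
  measurable_fun setT g -> (forall x, (0 <= g x)%R) ->
  exists nu : {measure set T -> \bar R},
    forall A, measurable A -> nu A = \int[m]_(x in A) (g x)%:E.
Proof.
move=> mg g0; pose F (A : set T) := \int[m]_(x in A) (g x)%:E.
have F0 : F set0 = 0 by exact: integral_set0.
have Fge0 A : 0 <= F A by apply: integral_ge0 => x _; rewrite lee_fin.
have Fsigma : semi_sigma_additive F.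
  move=> A mA tA mUA; have -> : F (\bigcup_n A n) = \sum_(n <oo) F (A n).
    apply: ge0_integral_bigcup => // [|x _]; last by rewrite lee_fin.
    by apply/measurable_EFinP; exact: measurable_funTS.
  by apply: is_cvg_nneseries => n _ _; exact: Fge0.
pose nu : {measure set T -> \bar R} := HB.pack F (isMeasure.Build _ _ _ F F0 Fge0 Fsigma).
by exists nu.
Qed.

Import HBNNSimple.

Lemma ge0_integral_density (nu : {measure set T -> \bar R}) (rho : T -> R)
    (f : T -> \bar R) :
  measurable_fun setT rho -> (forall x, (0 <= rho x)%R) ->
  (forall A, measurable A -> nu A = \int[m]_(x in A) (rho x)%:E) ->
  measurable_fun setT f -> (forall x, 0 <= f x) ->
  \int[nu]_x f x = \int[m]_x (f x * (rho x)%:E).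
Proof.
move=> mrho rho0 nuE mf f0; pose h := nnsfun_approx measurableT mf.
have mrhoE : measurable_fun setT (EFin \o rho) by exact/measurable_EFinP.
have cvgh x : EFin (h n x) @[n --> \oo] --> f x by exact: cvg_nnsfun_approx.
have ndh x a b : (a <= b)%N -> (h a x <= h b x)%R.
  by move=> ab; exact/lefP/nd_nnsfun_approx.
have mh n : measurable_fun setT (EFin \o h n).
  exact/measurable_EFinP/measurable_funP.
have -> : \int[nu]_x f x = limn (fun n => \int[nu]_x (h n x)%:E).
  rewrite -monotone_convergence//.
  - by apply: eq_integral => x _; exact/esym/cvg_lim.
  - by move=> n x _; rewrite lee_fin.
  - by move=> x _ a b ab; rewrite lee_fin ndh.
have -> : \int[m]_x (f x * (rho x)%:E) =
    limn (fun n => \int[m]_x ((h n x)%:E * (rho x)%:E)).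
  rewrite -monotone_convergence//.
  - apply: eq_integral => x _; apply/esym/cvg_lim => //.
    by apply: cvgeZr; [rewrite fin_numE|exact: cvgh].
  - by move=> n; apply: emeasurable_funM; [exact: mh|exact: mrhoE].
  - by move=> n x _; rewrite mule_ge0// lee_fin.
  - by move=> x _ a b ab; rewrite lee_wpmul2r ?lee_fin// ndh.
suff suf n : \int[nu]_x (h n x)%:E = \int[m]_x ((h n x)%:E * (rho x)%:E).
  by under eq_fun do rewrite suf.
have mpre r : measurable (h n @^-1` [set r]) by exact: measurable_sfunP.
have mind r : measurable_fun setT (fun x => (r * \1_(h n @^-1` [set r]) x)%:E).
  by apply/measurable_EFinP; apply: measurable_funM.
transitivity (\int[nu]_x
    (\sum_(y \in range (h n)) (y * \1_(h n @^-1` [set y]) x)%:E)).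
  by apply: eq_integral => t _; rewrite /= fimfunE -fsumEFin.
rewrite ge0_integral_fsum//; last by move=> y x _; exact: nnfun_muleindic_ge0.
transitivity (\int[m]_x (\sum_(y \in range (h n))
    (y * \1_(h n @^-1` [set y]) x)%:E * (rho x)%:E)); last first.
  apply: eq_integral => x _.
  rewrite -ge0_mule_fsuml => [|y]; last exact: nnfun_muleindic_ge0.
  by rewrite fsumEFin// -(fimfunE _ x).
rewrite ge0_integral_fsum//; last 2 first.
  - by move=> y; apply: emeasurable_funM; [exact: mind|exact: mrhoE].
  - by move=> y x _; apply: mule_ge0; [exact: nnfun_muleindic_ge0|rewrite lee_fin].
apply: eq_fsbigr => r rhn.
have r0 : (0 <= r)%R by move: rhn; rewrite inE => -[t _ <-].
under eq_integral do rewrite EFinM.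
rewrite ge0_integralZl//; last exact/measurable_EFinP.
under [RHS]eq_integral do rewrite EFinM -muleA.
rewrite [RHS]ge0_integralZl//; last 2 first.
  - by apply: emeasurable_funM; [exact/measurable_EFinP|exact: mrhoE].
  - by move=> x _; rewrite mule_ge0// lee_fin.
congr (_ * _); rewrite integral_indic// setIT nuE//.
rewrite integral_mkcond; apply: eq_integral => x _.
by rewrite muleC epatch_indic.
Qed.

End density_measures.

Section log_lipschitz_densities.
Context d (R : realType) (X : borelMetricType d R).
Variables (Y : set X) (m : probability X R).
Implicit Types (rho : X -> R) (k : R).

(** The multiplicative form of the seminorm bound: it includes the value 0 of a density and passes
    to sums termwise. *)
Definition LL_bound k rho := forall y y', Y y -> Y y' ->
  (rho y <= rho y' * expR (k * mdist y y'))%R.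

Lemma LLnorm_leP k rho : (0 <= k)%R -> (forall x, 0 <= rho x)%R ->
  LLnorm Y rho <= k%:E <-> LL_bound k rho.
Proof.
move=> k0 rho0; split=> [rhok y y' Yy Yy'|rhok].
  have [->|yy'] := pselect (y = y').
    by rewrite mdistxx mulr0 expR0 mulr1.
  have d0 : (0 < mdist y y')%R by rewrite mdist_gt0; exact/eqP.
  have : log_diff (rho y) (rho y') * ((mdist y y')^-1)%:E <= k%:E.
    by apply: le_trans rhok; apply: ereal_sup_ubound; exists (y, y').
  rewrite -lee_pdivlMr ?invr_gt0// invrK => ld.
  have [ry0|ryn0] := eqVneq (rho y) 0%R; first by rewrite ry0 mulr_ge0 ?expR_ge0.
  have ry : (0 < rho y)%R by rewrite lt_neqAle eq_sym ryn0 rho0.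
  move: ld; rewrite /log_diff (negbTE ryn0) andFb lne_EFin//.
  have [ry'0|ry'n0] := eqVneq (rho y') 0%R; first by rewrite ry'0 le0_lneNy.
  have ry' : (0 < rho y')%R by rewrite lt_neqAle eq_sym ry'n0 rho0.
  rewrite lne_EFin//= -EFinM lee_fin => /ler_normlW ld.
  rewrite -[leLHS]lnK ?posrE// -[X in (X * _)%R]lnK ?posrE// -expRD ler_expR.
  by rewrite -lerBlDl.
apply: ge_ereal_sup => _ [[y y'] /= [Yy Yy' yy'] <-].
have d0 : (0 < mdist y y')%R by rewrite mdist_gt0; exact/eqP.
rewrite -lee_pdivlMr ?invr_gt0// invrK /log_diff.
have := rhok _ _ Yy Yy'; have := rhok _ _ Yy' Yy; rewrite [mdist y' y]metric_sym.
have [->|ryn0] := eqVneq (rho y) 0%R.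
  rewrite mul0r => ry' _; have -> : rho y' = 0%R by apply/le_anti; rewrite ry' rho0.
  by rewrite eqxx andbT -EFinM lee_fin mulr_ge0// ltW.
have ry : (0 < rho y)%R by rewrite lt_neqAle eq_sym ryn0 rho0.
have [->|ry'n0] := eqVneq (rho y') 0%R; first by move=> _; rewrite mul0r leNgt ry.
have ry' : (0 < rho y')%R by rewrite lt_neqAle eq_sym ry'n0 rho0.
rewrite andFb !lne_EFin//= -EFinM lee_fin => h1 h2.
have lnle a b : (0 < a)%R -> (0 < b)%R -> (a <= b * expR (k * mdist y y') ->
    ln a - ln b <= k * mdist y y')%R.
  move=> a0 b0; rewrite -[X in (X <= _)%R -> _]lnK ?posrE//.
  by rewrite -[X in (_ <= X * _)%R -> _]lnK ?posrE// -expRD ler_expR lerBlDl.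
by rewrite ler_norml -lerNl opprB !lnle.
Qed.

Lemma LL_leP (nu : set X -> \bar R) k : (0 <= k)%R ->
  LL_le Y m nu k <-> exists2 rho, density m nu rho & LL_bound k rho.
Proof.
move=> k0; split=> -[rho drho rhok]; exists rho => //; have [_ rho0 _] := drho;
  exact/(LLnorm_leP k0 rho0).
Qed.

Lemma LL_le_ext (nu nu' : set X -> \bar R) k :
  (forall A, measurable A -> nu A = nu' A) -> LL_le Y m nu k -> LL_le Y m nu' k.
Proof.
move=> nunu' [rho [mrho rho0 nuE] rhok]; exists rho => //; split => // A mA.
by rewrite -nunu'// nuE.
Qed.

Lemma LL_le_zero (nu : set X -> \bar R) k : (0 <= k)%R ->
  (forall A, measurable A -> nu A = 0) -> LL_le Y m nu k.
Proof.
move=> k0 nu0; apply/LL_leP => //; exists (fun=> 0%R); last first.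
  by move=> y y' _ _; rewrite mul0r.
by split => // A mA; rewrite nu0// integral0.
Qed.

Lemma LL_le_trans (nu : set X -> \bar R) k k' : (k <= k')%R ->
  LL_le Y m nu k -> LL_le Y m nu k'.
Proof.
by move=> kk' [rho drho rhok]; exists rho => //; rewrite (le_trans rhok).
Qed.

Hypotheses (mY : measurable Y) (m_Y : m Y = 1).
Variable D : R.
Hypothesis distD : forall x y : X, (mdist x y <= D)%R.

Lemma integral_on_Y (f : X -> \bar R) A : measurable A -> measurable_fun setT f ->
  (forall x, 0 <= f x) -> \int[m]_(x in A) f x = \int[m]_(x in A `&` Y) f x.
Proof.
move=> mA mf f0; have mYC0 : m (~` Y) = 0.
  by rewrite probability_setC// m_Y subee.
rewrite (@ge0_negligible_integral _ _ _ _ A (~` Y))//; last 2 first.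
- exact: measurableC.
- exact: measurable_funTS.
by rewrite setDE setCK.
Qed.

Lemma mass_on_Y A : measurable A -> m (A `&` Y) = m A.
Proof.
move=> mA; have := integral_on_Y mA (@measurable_cst _ _ _ _ setT (1%:E : \bar R)).
by rewrite !integral_cst ?mul1e//; [move=> -> //|exact: measurableI].
Qed.

(** Integrate the comparison of rho y with rho x over x in Y, where m has mass 1. *)
Lemma density_bounds (nu : set X -> \bar R) rho k (v : R) y : (0 <= k)%R ->
  nu setT = v%:E -> density m nu rho -> LL_bound k rho -> Y y ->
  (expR (- (k * D)) * v <= rho y <= expR (k * D) * v)%R.
Proof.
move=> k0 nuv drho rhok Yy.
have [mrho rho0 nuE] := drho.
have mrhoE : measurable_fun setT (EFin \o rho) by exact/measurable_EFinP.
have eD (z z' : X) : (expR (k * mdist z z') <= expR (k * D))%R.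
  by rewrite ler_expR; apply: ler_wpM2l; [exact: k0|exact: distD].
have intY : \int[m]_(x in Y) (rho x)%:E = v%:E.
  by rewrite -nuv nuE// (integral_on_Y measurableT)// ?setTI// => x; rewrite lee_fin.
have cstY (a : R) : \int[m]_(x in Y) (cst a%:E x) = a%:E.
  by rewrite integral_cst// [X in _ * X]m_Y mule1.
rewrite -!lee_fin; apply/andP; split.
- rewrite expRN lee_fin ler_pdivrMl ?expR_gt0// -lee_fin -intY -cstY.
  apply: ge0_le_integral => //.
  + by move=> x _; rewrite lee_fin.
  + exact: measurable_funTS.
  + move=> x Yx /=; rewrite lee_fin (le_trans (rhok _ _ Yx Yy))// mulrC ler_wpM2r//.
- rewrite EFinM -intY.
  rewrite -ge0_integralZl ?lee_fin ?expR_ge0//; last 2 first.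
  + exact: measurable_funTS.
  + by move=> x _; rewrite lee_fin.
  rewrite -cstY; apply: ge0_le_integral => //.
  + by move=> x _; rewrite lee_fin.
  + by apply: measurable_funTS; exact: measurable_funeM.
  + move=> x Yx /=; rewrite lee_fin (le_trans (rhok _ _ Yy Yx))// mulrC ler_wpM2r//.
Qed.

Lemma LL_le_mass (nu : set X -> \bar R) k (v : R) : (0 <= k)%R ->
  nu setT = v%:E -> LL_le Y m nu k -> exists rho, [/\ density m nu rho,
    LL_bound k rho & forall y, Y y ->
      (expR (- (k * D)) * v <= rho y <= expR (k * D) * v)%R].
Proof.
move=> k0 nuv /(LL_leP nu k0)[rho drho rhok]; exists rho; split => // y.
exact: density_bounds drho rhok.
Qed.

Lemma LL_le_upper (nu : set X -> \bar R) k (v : R) A : (0 <= k)%R ->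
  nu setT = v%:E -> LL_le Y m nu k -> measurable A ->
  nu A <= (expR (k * D) * v)%:E * m A.
Proof.
move=> k0 nuv nuk mA; have [rho [[mrho rho0 nuE] _ rhoD]] := LL_le_mass k0 nuv nuk.
have mrhoE : measurable_fun setT (EFin \o rho) by exact/measurable_EFinP.
have mAY : measurable (A `&` Y) by exact: measurableI.
rewrite nuE// (integral_on_Y mA mrhoE); last by move=> x; rewrite lee_fin.
rewrite -(mass_on_Y mA) -integral_cst//.
apply: ge0_le_integral => //.
- by move=> x _; rewrite lee_fin.
- exact: measurable_funTS.
- by move=> x [_ Yx] /=; rewrite lee_fin; have /andP[] := rhoD x Yx.
Qed.

Lemma LL_le_lower (nu : set X -> \bar R) k (v : R) A : (0 <= k)%R ->
  nu setT = v%:E -> LL_le Y m nu k -> measurable A -> (0 <= v)%R ->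
  (expR (- (k * D)) * v)%:E * m A <= nu A.
Proof.
move=> k0 nuv nuk mA v0; have [rho [[mrho rho0 nuE] _ rhoD]] := LL_le_mass k0 nuv nuk.
have mrhoE : measurable_fun setT (EFin \o rho) by exact/measurable_EFinP.
have mAY : measurable (A `&` Y) by exact: measurableI.
rewrite nuE// (integral_on_Y mA mrhoE); last by move=> x; rewrite lee_fin.
rewrite -(mass_on_Y mA) -integral_cst//.
apply: ge0_le_integral => //.
- by move=> x _; rewrite lee_fin mulr_ge0 ?expR_ge0.
- exact: measurable_funTS.
- by move=> x [_ Yx] /=; rewrite lee_fin; have /andP[] := rhoD x Yx.
Qed.

End log_lipschitz_densities.

(** * Summing log-Lipschitz measures and splitting off a multiple of m *)

Section log_lipschitz_operations.
Context d (R : realType) (X : borelMetricType d R).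
Variables (Y : set X) (m : probability X R).
Hypotheses (mY : measurable Y) (m_Y : m Y = 1).
Variable D : R.
Hypothesis distD : forall x y : X, (mdist x y <= D)%R.

(** The densities add up. On Y the sum is finite because each density is there at most exp(k D)
    times its mass, and the masses have a finite sum. *)
Lemma LL_le_series (nu : set X -> \bar R) (nu_ : nat -> set X -> \bar R) (k v : R) :
  (0 <= k)%R -> nu setT = v%:E -> (forall i, LL_le Y m (nu_ i) k) ->
  (forall A, measurable A -> nu A = \sum_(i <oo) nu_ i A) -> LL_le Y m nu k.
Proof.
move=> k0 nuv nuk nuE.
have [rho_ hrho] : exists rho_ : nat -> X -> R,
    forall i, density m (nu_ i) (rho_ i) /\ LL_bound Y k (rho_ i).
  have /choice[rho_ hrho] : forall i, exists rho,
      density m (nu_ i) rho /\ LL_bound Y k rho.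
    by move=> i; have /(LL_leP Y m _ k0)[rho] := nuk i; exists rho.
  by exists rho_.
have rho0 i x : (0 <= rho_ i x)%R by have [[]] := hrho i.
have mrho i : measurable_fun setT (fun x => (rho_ i x)%:E).
  by have [[? _ _] _] := hrho i; exact/measurable_EFinP.
have nu_E i A : measurable A -> nu_ i A = \int[m]_(x in A) (rho_ i x)%:E.
  by have [[_ _ h] _] := hrho i; exact: h.
have nu_0 i A : measurable A -> 0 <= nu_ i A.
  by move=> mA; rewrite nu_E//; apply: integral_ge0 => x _; rewrite lee_fin.
have nu_fin i : nu_ i setT \is a fin_num.
  rewrite ge0_fin_numE ?nu_0// (@le_lt_trans _ _ (nu setT))//; last by rewrite nuv ltry.
  rewrite nuE// (@nneseriesD1 _ _ i)// => [|j _]; last exact: nu_0.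
  by rewrite leeDl// nneseries_ge0// => j _ _; exact: nu_0.
pose S x := \sum_(i <oo) (rho_ i x)%:E.
have S0 x : 0 <= S x by apply: nneseries_ge0 => i _ _; rewrite lee_fin.
have mS : measurable_fun setT S.
  apply: (@ge0_emeasurable_sum _ _ _ setT (fun i x => (rho_ i x)%:E) xpredT) => //.
  by move=> i x _ _; rewrite lee_fin.
have SY x : Y x -> S x \is a fin_num.
  move=> Yx; rewrite ge0_fin_numE//.
  apply: (@le_lt_trans _ _ (\sum_(i <oo) (expR (k * D))%:E * nu_ i setT)).
    apply: lee_nneseries => [i _ _|i _]; first by rewrite lee_fin.
    have fi := nu_fin i; rewrite -(fineK fi) -EFinM lee_fin.
    have [di bi] := hrho i.
    by have /andP[] := density_bounds mY m_Y distD k0 (esym (fineK fi)) di bi Yx.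
  rewrite nneseriesZl//; last by move=> i _; exact: nu_0.
  by rewrite -nuE// nuv -EFinM ltry.
(* Off Y the sum may be infinite; m does not charge this set, so the density is set to 0 there. *)
pose rho x := fine ((S \_ Y) x).
have rhoE x : (rho x)%:E = (S \_ Y) x.
  by rewrite /rho fineK// patchE; case: ifPn => //; rewrite inE; exact: SY.
apply/(LL_leP Y m _ k0); exists rho; last first.
  move=> y y' Yy Yy'; rewrite -lee_fin EFinM !rhoE !patchE !mem_set//.
  rewrite muleC -nneseriesZl; last by move=> i _; rewrite lee_fin.
  apply: lee_nneseries => [i _ _|i _]; first by rewrite lee_fin.
  by rewrite -EFinM lee_fin mulrC; have [_] := hrho i; exact.
have mSY : measurable_fun setT (S \_ Y).
  by apply/(measurable_restrictT _ mY); exact: measurable_funTS.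
split.
- by apply: measurableT_comp => //; exact: mSY.
- by move=> x; rewrite fine_ge0// patchE; case: ifPn.
- move=> A mA; rewrite nuE//.
  under [RHS]eq_integral do rewrite rhoE.
  rewrite -integral_mkcondr -(integral_on_Y mY m_Y)// /S integral_nneseries//.
  + by apply: eq_eseriesr => i _; exact: nu_E.
  + by move=> i; exact: measurable_funTS.
  + by move=> i x _; rewrite lee_fin.
Qed.

(** Convexity of exp: K1 t lies at the fraction K1/K2 of the way from 0 to K2 t. The two bounds
    below are the tangent at K1 t, evaluated at both ends. *)
Lemma expR_chord (K1 K2 t : R) : (0 < K1)%R -> (K1 < K2)%R -> (0 <= t)%R ->
  (expR (K1 * t) <= K1 / K2 * expR (K2 * t) + (1 - K1 / K2))%R.
Proof.
move=> K10 K12 t0; have K20 : (0 < K2)%R by rewrite (lt_trans K10).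
set a := (K1 / K2)%R; have aK : (a * K2 = K1)%R by rewrite /a divfK// gt_eqF.
have a0 : (0 <= a)%R by rewrite divr_ge0 ?ltW.
have a1 : (0 <= 1 - a)%R by rewrite subr_ge0 ler_pdivrMr// mul1r ltW.
set z := expR (K1 * t); have z0 : (0 < z)%R by exact: expR_gt0.
have h1 : (z * (1 + (K2 - K1) * t) <= expR (K2 * t))%R.
  have -> : (K2 * t = K1 * t + (K2 - K1) * t)%R by ring.
  by rewrite expRD ler_wpM2l ?(ltW z0)// expR_ge1Dx.
have h2 : (z * (1 - K1 * t) <= 1)%R.
  rewrite -[leRHS](expRxMexpNx_1 (K1 * t)).
  by rewrite ler_wpM2l ?(ltW z0)// expR_ge1Dx.
have := ler_wpM2l a0 h1; have := ler_wpM2l a1 h2.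
have : (a * K2 * (z * t) = K1 * (z * t))%R by rewrite aK.
lra.
Qed.

(** At a point that f sends to y in Y the fraction a / rho(y) of the mass is removed. What is
    removed is pushed to a m, and the rest arrives with density rho - a. The bound on a gives a <=
    rho/2, and enough room for the constant K2. *)
Lemma exists_extraction (M : {measure set X -> \bar R}) (f : X -> X)
    (K1 K2 v a : R) :
  measurable_fun setT f -> (0 < K1)%R -> (K1 < K2)%R ->
  M (f @^-1` Y) = v%:E -> LL_le Y m (fun A => M (f @^-1` (A `&` Y))) K1 ->
  (0 <= a <= expR (- (K1 * D)) * Num.min 2^-1 (1 - K1 / K2) * v)%R ->
  exists M' E : {measure set X -> \bar R},
    [/\ (forall A, measurable A -> M A = M' A + E A),
        (forall A, measurable A -> M A <= 2%:E * M' A),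
        E (~` (f @^-1` Y)) = 0,
        (forall A, measurable A -> E (f @^-1` A) = a%:E * m A)
      & LL_le Y m (fun A => M' (f @^-1` (A `&` Y))) K2].
Proof.
move=> mf K10 K12 Mv nuK /andP[a0 av].
have K20 : (0 < K2)%R by rewrite (lt_trans K10).
have mfA A : measurable A -> measurable (f @^-1` A).
  by move=> mA; rewrite -[X in measurable X]setTI; exact: mf.
have mfY := mfA _ mY.
have nuT : (fun A => M (f @^-1` (A `&` Y))) setT = v%:E by rewrite /= setTI.
(* The case a = 0 covers v = 0, where the density may vanish; for a > 0 it is positive on Y. *)
move: a0; rewrite le_eqVlt => /predU1P[a0|a0].
  exists M, mzero; split => //.
  - by move=> A mA; rewrite /mzero adde0.
  - by move=> A mA; rewrite -[leLHS]mul1e lee_wpmul2r// lee_fin ler1n.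
  - by move=> A mA; rewrite -a0 mul0e.
  - exact: LL_le_trans (ltW K12) nuK.
have [rho [[mrho rho0 nuE] rhoK rhoD]] := LL_le_mass mY m_Y distD (ltW K10) nuT nuK.
set t := Num.min _ _ in av.
have t2 : (t <= 2^-1)%R by rewrite /t ge_min lexx.
have tK : (t <= 1 - K1 / K2)%R by rewrite /t ge_min lexx orbT.
have t0 : (0 < t)%R.
  by rewrite /t lt_min invr_gt0 ltr0n/= subr_gt0 ltr_pdivrMr// mul1r.
have arho y : Y y -> (a <= t * rho y)%R.
  move=> Yy; rewrite (le_trans av)// mulrAC mulrC ler_wpM2l ?(ltW t0)//.
  by have /andP[] := rhoD y Yy.
have rhop y : Y y -> (0 < rho y)%R.
  by move=> Yy; rewrite -(pmulr_rgt0 _ t0) (lt_le_trans a0)// arho.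
(* The inverse is written as a power, whose measurability is then used; the indicator of Y puts psi
   to 0 where rho has no lower bound. *)
pose psi x := (a * (rho x) `^ (-1) * \1_Y x)%R.
have psiE x : Y x -> psi x = (a / rho x)%R.
  by move=> Yx; rewrite /psi powR_inv1// indicE mem_set// mulr1.
have psiN x : ~ Y x -> psi x = 0%R.
  by move=> Yx; rewrite /psi indicE memNset// mulr0.
have psi0 x : (0 <= psi x)%R.
  by rewrite /psi mulr_ge0// mulr_ge0 ?powR_ge0// ltW.
have psit x : (psi x <= 2^-1)%R.
  have [Yx|Yx] := pselect (Y x); last by rewrite psiN.
  rewrite psiE// ler_pdivrMr ?rhop// (le_trans (arho _ Yx))//.
  by rewrite ler_wpM2r// rho0.
have mpsi : measurable_fun setT psi.
  apply: measurable_funM => //; apply: measurable_funM => //.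
  by apply: (measurableT_comp (measurable_powR _)).
have mphi : measurable_fun setT (fun x => 1 - psi x)%R by exact: measurable_funB.
have phi0 x : (0 <= 1 - psi x)%R by rewrite subr_ge0 (le_trans (psit x))// invf_le1// ler1n.
pose Mr : {measure set X -> \bar R} := mrestr M mfY.
have push (g : X -> R) A : measurable_fun setT g -> (forall x, (0 <= g x)%R) ->
    measurable A ->
    \int[Mr]_(x in f @^-1` A) (g (f x))%:E = \int[m]_(x in A) (g x * rho x)%:E.
  move=> mg g0 mA.
  have mgE : measurable_fun setT (EFin \o g) by exact/measurable_EFinP.
  have mgA : measurable_fun setT ((EFin \o g) \_ A).
    by apply/(measurable_restrictT _ mA); exact: measurable_funTS.
  transitivity (\int[pushforward Mr f]_(y in A) (g y)%:E).
    rewrite ge0_integral_pushforward//; first exact: measurable_funTS.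
    by move=> x _; rewrite lee_fin.
  rewrite integral_mkcond (@ge0_integral_density _ _ _ m _ rho)//.
  - rewrite [RHS]integral_mkcond; apply: eq_integral => x _.
    by rewrite !patchE; case: ifPn => _; rewrite ?mul0e// EFinM.
  - by move=> x; rewrite patchE; case: ifPn => // _; rewrite lee_fin.
have mcomp (g : X -> R) : measurable_fun setT g -> measurable_fun setT (g \o f).
  by move=> mg; exact: measurableT_comp.
have [E EE] := exists_density_measure Mr (mcomp _ mpsi) (fun x => psi0 (f x)).
have [B BE] := exists_density_measure Mr (mcomp _ mphi) (fun x => phi0 (f x)).
have mfYC : measurable (~` (f @^-1` Y)) by exact: measurableC.
pose M' : {measure set X -> \bar R} := measure_add (mrestr M mfYC) B.
have M'E A : M' A = M (A `\` f @^-1` Y) + B A by exact: measure_addE.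
have mpsiE : measurable_fun setT (fun x => (psi (f x))%:E).
  by apply/measurable_EFinP; exact: mcomp.
have mphiE : measurable_fun setT (fun x => (1 - psi (f x))%:E).
  by apply/measurable_EFinP; exact: (mcomp _ mphi).
have BEr A : measurable A -> B A + E A = Mr A.
  move=> mA; rewrite BE// EE// -ge0_integralD//.
  - under eq_integral do rewrite /= -EFinD subrK.
    by rewrite integral_cst// mul1e.
  - by move=> x _; rewrite lee_fin phi0.
  - exact: measurable_funTS.
  - by move=> x _; rewrite lee_fin psi0.
  - exact: measurable_funTS.
exists M', E; split.
- by move=> A mA; rewrite M'E -addeA BEr// (measureDI M mA mfY).
- move=> A mA; rewrite M'E (measureDI M mA mfY) ge0_muleDr//.
  apply: leeD; first by rewrite -[leLHS]mul1e lee_wpmul2r// ?lee_fin ?ler1n.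
  rewrite -[X in X <= _]/(Mr A) BE// -ge0_integralZl//; last 2 first.
  + exact: measurable_funTS.
  + by move=> x _; rewrite lee_fin phi0.
  rewrite -[X in X <= _]mul1e -integral_cst//; apply: ge0_le_integral => //.
  + apply: measurable_funTS; exact: measurable_funeM.
  + by move=> x _; rewrite -EFinM lee_fin /=; have := psit (f x); lra.
- apply/eqP; rewrite -measure_le0.
  have Mr0 : Mr (~` (f @^-1` Y)) = 0.
    by rewrite -[LHS]/(M (~` (f @^-1` Y) `&` f @^-1` Y)) setICl measure0.
  by rewrite -Mr0 -BEr// leeDr.
- move=> A mA; rewrite EE// ?push//; last exact: mfA.
  rewrite (integral_on_Y mY m_Y)//; last 2 first.
  + by apply/measurable_EFinP; exact: measurable_funM.
  + by move=> x; rewrite lee_fin mulr_ge0.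
  rewrite -(mass_on_Y mY m_Y mA) -integral_cst//; last exact: measurableI.
  apply: eq_integral => x; rewrite inE => -[_ Yx].
  by rewrite psiE// divfK// gt_eqF// rhop.
apply/(LL_leP Y m _ (ltW K20)); exists (fun x => (1 - psi x) * rho x)%R.
  split; first exact: measurable_funM.
    by move=> x; rewrite mulr_ge0.
  move=> A mA; have mAY : measurable (A `&` Y) by exact: measurableI.
  rewrite M'E (_ : _ `\` _ = set0) ?measure0 ?add0e; last first.
    by apply/seteqP; split => // x [[_ Yx] /(_ Yx)].
  rewrite BE; last exact: mfA.
  rewrite [RHS](integral_on_Y mY m_Y)//.
  + exact: (push (fun x => 1 - psi x)%R).
  + by apply/measurable_EFinP; exact: measurable_funM.
  + by move=> x; rewrite lee_fin mulr_ge0.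
move=> y y' Yy Yy'; rewrite !psiE// !mulrBl !mul1r !divfK ?gt_eqF ?rhop//.
have := rhoK _ _ Yy Yy'; have := arho _ Yy'.
have d0 : (0 <= mdist y y')%R by exact: mdist_ge0.
have := expR_chord K10 K12 d0; set e1 := expR (K1 * _); set e2 := expR (K2 * _).
have e21 : (1 <= e2)%R by rewrite -expR0 ler_expR mulr_ge0// ltW.
move=> e12 ar r12; have ry := ltW (rhop _ Yy').
(* By the chord inequality (1 - K1/K2) (e2 - 1) <= e2 - e1, so a (e2 - 1) <= rho(y') (e2 - e1),
   which is e1 rho(y') - a <= e2 (rho(y') - a). *)
have : (a * (e2 - 1) <= (1 - K1 / K2) * rho y' * (e2 - 1))%R.
  by rewrite ler_wpM2r ?subr_ge0// (le_trans ar)// ler_wpM2r.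
have := ler_wpM2l ry e12; lra.
Qed.

End log_lipschitz_operations.

(** * Return times *)

Section return_times.
Context d (R : realType) (X : borelMetricType d R).
Implicit Types (T : nat -> X -> X) (Y : set X).

Definition shift T (u k : nat) : X -> X := T (u + k)%N.

Definition avoid Y T (i j : nat) : set X :=
  [set x | forall k, (i < k <= j)%N -> ~ Y (traj T k x)].

Definition first_return Y T (n : nat) : set X :=
  [set x | Y (traj T n x) /\ avoid Y T 0 n.-1 x].

Lemma traj_shift T u k x : traj (shift T u) k (traj T u x) = traj T (u + k) x.
Proof.
elim: k => [|k IH]; first by rewrite addn0.
by rewrite addnS /= IH.
Qed.

Lemma measurable_traj T n : (forall k, measurable_fun setT (T k)) ->
  measurable_fun setT (traj T n).
Proof.
move=> mT; elim: n => [|n IH] /=; first exact: measurable_id.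
exact: measurableT_comp.
Qed.

Lemma measurable_traj_preimage T n A : (forall k, measurable_fun setT (T k)) ->
  measurable A -> measurable (traj T n @^-1` A).
Proof.
by move=> mT mA; rewrite -[X in measurable X]setTI; exact: measurable_traj.
Qed.

Lemma measurable_avoid Y T i j : (forall k, measurable_fun setT (T k)) ->
  measurable Y -> measurable (avoid Y T i j).
Proof.
move=> mT mY; have -> : avoid Y T i j =
    \bigcap_(k in [set k | (i < k <= j)%N]) ~` (traj T k @^-1` Y) by [].
apply: bigcap_measurableType => k _.
by apply: measurableC; exact: measurable_traj_preimage.
Qed.

Lemma measurable_first_return Y T n : (forall k, measurable_fun setT (T k)) ->
  measurable Y -> measurable (first_return Y T n).
Proof.
move=> mT mY; apply: measurableI; first exact: measurable_traj_preimage.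
exact: measurable_avoid.
Qed.

Lemma tau_ge Y T n x : (n%:R)%:E <= tau Y T x <-> avoid Y T 0 n.-1 x.
Proof.
split=> [ntau k /andP[k0 kn] Yk|av].
  have : tau Y T x <= (k%:R)%:E by apply: ereal_inf_lbound; exists k.
  move=> /(le_trans ntau); rewrite lee_fin ler_nat; lia.
apply: le_ereal_inf_tmp => _ [k [k1 Yk] <-]; rewrite lee_fin ler_nat leqNgt.
by apply/negP => kn; apply: (av k) => //; lia.
Qed.

Lemma tau_eq Y T n x : tau Y T x = (n%:R)%:E -> (0 < n)%N /\ first_return Y T n x.
Proof.
move=> taun; have av : avoid Y T 0 n.-1 x by apply/tau_ge; rewrite taun.
have [_ [k [k1 Yk] <-]] : exists2 y, [set (n%:R)%:E | n in [set n | (1 <= n)%N /\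
    Y (traj T n x)]] y & y < (n.+1%:R)%:E :> \bar R.
  by apply: ereal_inf_lt; rewrite -/(tau Y T x) taun lte_fin ltr_nat.
rewrite lte_fin ltr_nat ltnS leq_eqVlt => /predU1P[kn|kn].
  by rewrite -kn in av *; split => //; split.
exfalso; apply: (av k) => //; lia.
Qed.

Lemma first_return_tau Y T n x : (0 < n)%N -> first_return Y T n x ->
  tau Y T x = (n%:R)%:E.
Proof.
move=> n0 [Yn av]; apply/le_anti; apply/andP; split; last exact/tau_ge.
by apply: ereal_inf_lbound; exists n.
Qed.

End return_times.

(** * The flow of the remaining mass *)

Lemma measurable_cover d (T : measurableType d) (P : set (set T)) :
  countable P -> (forall a, P a -> measurable a) -> measurable (cover P id).
Proof.
move=> /countable_injP[f finj] mP.
pose B i := [set x | exists2 a, P a /\ f a = i & a x].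
have -> : cover P id = \bigcup_i B i.
  apply/seteqP; split=> [x [a Pa ax]|x [i _ [a [Pa _] ax]]]; last by exists a.
  by exists (f a) => //; exists a.
apply: bigcup_measurable => i _.
have [[a [Pa fa]]|no] := pselect (exists a, P a /\ f a = i); last first.
  rewrite (_ : B i = set0); first exact: measurable0.
  by apply/seteqP; split => // x [a Pa _]; apply: no; exists a.
rewrite (_ : B i = a); first exact: mP.
apply/seteqP; split=> [x [b [Pb fb] bx]|x ax]; last by exists a.
by have <- : b = a by apply: finj; rewrite ?inE// fa fb.
Qed.

Section first_return_law.
Context d (R : realType) (X : borelMetricType d R).
Variables (c : constants R) (h : nat -> R) (Y : set X) (m : probability X R).
Variables (T : nat -> X -> X) (P : set (set X)).
Hypotheses (mY : measurable Y) (m_Y : m Y = 1) (mT : forall k, measurable_fun setT (T k)).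
Variable D : R.
Hypothesis distD : forall x y : X, (mdist x y <= D)%R.
Hypothesis nue : nonuniformly_expanding c h Y m T P.

(** Up to a kappa-null set, the points that first return at time n form the disjoint union of the
    atoms with tau = n, and each of these arrives with a log-Lipschitz density. *)
Lemma LL_le_first_return (kappa : {measure set X -> \bar R}) (k : R) (n : nat) :
  (0 <= k)%R -> kappa setT < +oo -> kappa (~` cover P id) = 0 ->
  (forall a (ma : measurable a) j, P a -> tau_on Y T a j ->
    LL_le Y m (pushforward (mrestr kappa ma) (traj T j)) k) -> (0 < n)%N ->
  LL_le Y m (fun A => kappa (first_return Y T n `&` traj T n @^-1` A)) k.
Proof.
move=> k0 kfin kcover kLL n0.
have mfr : measurable (first_return Y T n) by exact: measurable_first_return.
have /countable_injP[f finj] := P_countable nue.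
have [_ tP neP] := P_partition nue.
(* The atoms with tau = n, listed along the injection f into the naturals; other indices give the
   empty set. *)
pose B i := [set x | exists2 a, [/\ P a, f a = i & tau_on Y T a n] & a x].
have BE i : (exists a, [/\ P a, f a = i, tau_on Y T a n & B i = a]) \/ B i = set0.
  have [[a [Pa fa ta]]|no] := pselect (exists a, [/\ P a, f a = i & tau_on Y T a n]).
    left; exists a; split => //; apply/seteqP; split=> [x [b [Pb fb tb] bx]|x ax].
      by have <- : b = a by apply: finj; rewrite ?inE// fa fb.
    by exists a.
  right; apply/seteqP; split => // x [a [Pa fa ta] _]; apply: no.
  by exists a.
have mB i : measurable (B i).
  case: (BE i) => [[a [Pa _ _ ->]]|->]; last exact: measurable0.
  exact: P_measurable nue _ Pa.
have tB : trivIset setT B.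
  move=> i j _ _ [x [[a [Pa <- ta] ax] [b [Pb <- tb] bx]]].
  by congr f; apply: tP => //; exists x.
have kB A : measurable A -> kappa (first_return Y T n `&` traj T n @^-1` A) =
    \sum_(i <oo) kappa (B i `&` traj T n @^-1` A).
  move=> mA; have mtA : measurable (traj T n @^-1` A) by exact: measurable_traj_preimage.
  rewrite -measure_semi_bigcup//; last 3 first.
  - by move=> i; exact: measurableI.
  - by move=> i j _ _ [x [[Bix _] [Bjx _]]]; apply: tB => //; exists x.
  - by apply: bigcup_measurable => i _; exact: measurableI.
  have mC : measurable (cover P id).
    apply: (measurable_cover (P_countable nue)) => a.
    exact: P_measurable nue a.
  rewrite (measureDI _ (measurableI _ _ mfr mtA) mC).
  rewrite [X in X + _](_ : _ = 0) ?add0e; last first.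
    apply/eqP; rewrite -measure_le0 -[leRHS]kcover; apply: le_measure; rewrite ?inE.
    - by apply: measurableD => //; exact: measurableI.
    - exact: measurableC.
    - by move=> x [].
  congr (kappa _); apply/seteqP; split=> [x [[fr Ax] [a Pa ax]]|x [i _ [[a [Pa _ ta] ax] Ax]]].
    exists (f a) => //; split => //; exists a => //; split => // y ay.
    have [j tj] := NU2 nue Pa.
    by rewrite (tj y ay) -(tj x ax) (first_return_tau n0 fr).
  split; last by exists a.
  by split => //; have [] := tau_eq (ta x ax).
have kfin' : kappa (first_return Y T n) \is a fin_num.
  rewrite ge0_fin_numE// (le_lt_trans _ kfin)// le_measure ?inE//.
apply: (@LL_le_series _ _ _ Y m mY m_Y D distD _
  (fun i A => kappa (B i `&` traj T n @^-1` A)) k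
  (fine (kappa (first_return Y T n)))) => //.
- by rewrite preimage_setT setIT fineK.
- move=> i; case: (BE i) => [[a [Pa _ ta ->]]|->].
    have ma := P_measurable nue Pa.
    apply: LL_le_ext (kLL a ma n Pa ta) => A mA.
    by rewrite /pushforward /mrestr setIC.
  by apply: LL_le_zero => // A mA; rewrite set0I measure0.
Qed.

End first_return_law.

Section flow.
Context d (R : realType) (X : borelMetricType d R).
Variables (c : constants R) (h : nat -> R) (Y : set X) (m : probability X R).
Variables (TT : set (X -> X)) (P : (nat -> X -> X) -> set (set X)).
Hypothesis S : setting c h Y m TT P.
Let mY := Y_measurable S.
Let m_Y := m_Y S.

Lemma mdist_le_diam (x y : X) : (mdist x y <= cdiam c)%R.
Proof.
by rewrite (X_diam S); apply: ub_le_sup; [exact: X_bounded S|exists (x, y)].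
Qed.

Lemma TT_traj T (k : nat) : (forall k, TT (T k)) -> measurable_fun setT (T k).
Proof. by move=> TTT; exact: TT_measurable S _ (TTT k). Qed.

Let K1_ge0 : (0 <= cK1 c)%R. Proof. exact/ltW/(K1_gt0 S). Qed.
Let K2_ge0 : (0 <= cK2 c)%R.
Proof. exact/ltW/(lt_trans (K1_gt0 S) (K1_lt_K2 S)). Qed.

Definition regular_along T (kappa : {measure set X -> \bar R}) :=
  kappa (~` cover (P T) id) = 0 /\
  forall a (ma : measurable a) n, P T a -> tau_on Y T a n ->
    LL_le Y m (pushforward (mrestr kappa ma) (traj T n)) (cK1 c).

(** The choice of K1 and K2 settles the atoms inside Y, the atoms off Y carry no mass, and the
    exceptional null set is harmless because kappa has a density. *)
Lemma LL_le_regular_along T (kappa : {measure set X -> \bar R}) :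
  (forall k, TT (T k)) -> kappa (~` Y) = 0 -> LL_le Y m kappa (cK2 c) ->
  regular_along T kappa.
Proof.
move=> TTT kY kLL; have nue := TT_nue S TTT.
have mC : measurable (cover (P T) id).
  apply: (measurable_cover (P_countable nue)) => a.
  exact: P_measurable nue a.
split=> [|a ma n Pa ta].
  have [rho [mrho rho0 ->]] := kLL; last exact: measurableC.
  rewrite (@ge0_negligible_integral _ _ _ _ _ (~` cover (P T) id))//.
  - by rewrite setDv integral_set0.
  - exact: measurableC.
  - exact: measurableC.
  - by apply/measurable_funTS/measurable_EFinP.
  - by move=> x _; rewrite lee_fin.
  - exact: P_full nue.
case: (P_Y nue Pa) => [aY|aY]; first exact: K1_K2 S _ TTT _ kY kLL _ _ _ Pa aY ta.
apply: LL_le_zero => // A mA; rewrite /pushforward /mrestr.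
have mtA : measurable (traj T n @^-1` A).
  by apply: measurable_traj_preimage => // k; exact: TT_traj.
apply/eqP; rewrite -measure_le0 -[leRHS]kY le_measure ?inE//.
- exact: measurableI.
- exact: measurableC.
- move=> x [_ ax] Yx; have : (a `&` Y) x by split.
  by rewrite aY.
Qed.

Variable T : nat -> X -> X.
Hypothesis TTT : forall k, TT (T k).
Let mT k : measurable_fun setT (T k). Proof. exact: TT_traj. Qed.
Let TTshift u k : TT (shift T u k). Proof. exact: TTT. Qed.
Let mpre n A : measurable A -> measurable (traj T n @^-1` A).
Proof. exact: measurable_traj_preimage. Qed.

(** M and M' are the masses left before and after the removal at time n, kept as measures on the
    initial points; only points that are in Y at time n lose mass. *)
Record flow_step n (M M' : set X -> \bar R) : Prop := {
  flow_le : forall A, measurable A -> M' A <= M A;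
  flow_half : forall A, measurable A -> M A <= 2%:E * M' A;
  flow_off : forall A, measurable A -> A `<=` ~` (traj T n @^-1` Y) -> M' A = M A;
  flow_LL : LL_le Y m (fun A => M' (traj T n @^-1` (A `&` Y))) (cK2 c) }.

Definition flow (N : nat) (M : nat -> {measure set X -> \bar R}) :=
  [/\ M 0%N setT = 1, regular_along T (M 0%N)
    & forall n, (n < N)%N -> flow_step n.+1 (M n) (M n.+1)].

Variable M : nat -> {measure set X -> \bar R}.

Lemma flow_homo N i j A : flow N M -> (i <= j <= N)%N -> measurable A ->
  M j A <= M i A.
Proof.
move=> [_ _ fl] + mA; elim: j => [|j IH]; first by case: i.
move=> /andP[]; rewrite leq_eqVlt => /predU1P[->//|ij jN].
by rewrite (le_trans (flow_le (fl _ jN) mA))// IH// -ltnS ij ltnW.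
Qed.

Lemma flow_le1 N j A : flow N M -> (j <= N)%N -> measurable A -> M j A <= 1.
Proof.
move=> fl jN mA; rewrite (@le_trans _ _ (M 0%N A)) ?(flow_homo fl)//.
by have [<- _ _] := fl; rewrite le_measure ?inE.
Qed.

Lemma flow_fin N j A : flow N M -> (j <= N)%N -> measurable A ->
  M j A \is a fin_num.
Proof.
move=> fl jN mA; rewrite ge0_fin_numE// (le_lt_trans (flow_le1 fl jN mA))//.
by rewrite ltry.
Qed.

Lemma flow_double N i j A : flow N M -> (i <= j <= N)%N -> measurable A ->
  M i A <= (2 ^+ (j - i))%:E * M j A.
Proof.
move=> [_ _ fl] + mA; elim: j => [|j IH].
  by rewrite andbT leqn0 => /eqP ->; rewrite subnn expr0 mul1e.
move=> /andP[]; rewrite leq_eqVlt => /predU1P[->|ij jN].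
  by rewrite subnn expr0 mul1e.
rewrite subSn; last by rewrite -ltnS.
rewrite exprSr EFinM -muleA.
rewrite (le_trans (IH _))//; first by rewrite -ltnS ij ltnW.
by rewrite lee_wpmul2l ?lee_fin ?exprn_ge0// (flow_half (fl _ jN)).
Qed.

Lemma flow_avoid N i j A : flow N M -> (i <= j <= N)%N -> measurable A ->
  A `<=` avoid Y T i j -> M j A = M i A.
Proof.
move=> [_ _ fl] + mA; elim: j => [|j IH].
  by rewrite andbT leqn0 => /eqP ->.
move=> /andP[]; rewrite leq_eqVlt => /predU1P[->//|ij jN] av.
rewrite (flow_off (fl _ jN) mA); last first.
  by move=> x /av; apply; rewrite ij leqnn.
apply: IH; first by rewrite -ltnS ij ltnW.
by move=> x /av avx k /andP[ik kj]; apply: avx; rewrite ik leqW.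
Qed.

(** The value u = 0 means no visit at times 1, ..., N, wherever the orbit starts: the initial
    measure is regular off Y as well. *)
Definition last_visit u N : set X :=
  (if u is 0%N then setT else traj T u @^-1` Y) `&` avoid Y T u N.

Lemma measurable_last_visit u N : measurable (last_visit u N).
Proof.
apply: measurableI; last exact: measurable_avoid.
by case: u => // u; exact: mpre.
Qed.

Lemma trivIset_last_visit N : trivIset [set u | (u <= N)%N] (last_visit ^~ N).
Proof.
have lt u u' x : (u' <= N)%N -> last_visit u N x -> last_visit u' N x -> (u' <= u)%N.
  move=> u'N [_ av] [Y' _]; rewrite leqNgt; apply/negP => uu'.
  apply: (av u'); first by rewrite uu'.
  by case: u' uu' {u'N} Y'.
move=> u u' /= uN u'N [x [xu xu']]; apply/eqP; rewrite eqn_leq.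
by rewrite (lt _ _ _ _ xu' xu)//= (lt _ _ _ _ xu xu').
Qed.

Lemma last_visit_cover N x : exists2 u, (u <= N)%N & last_visit u N x.
Proof.
elim: N => [|N [u uN [Yu av]]].
  by exists 0%N => //; split => // k /andP[]; case: k.
have [YN|nYN] := pselect (Y (traj T N.+1 x)).
  by exists N.+1 => //; split => // k /andP[+ kN]; rewrite ltnNge kN.
exists u; first exact: leqW.
split => // k /andP[uk]; rewrite leq_eqVlt => /predU1P[->//|kN].
by apply: av; rewrite uk.
Qed.

Lemma last_visit_first_return u n N A : n = N.+1 -> (0 < u <= N)%N ->
  traj T u @^-1` (first_return Y (shift T u) (n - u)
    `&` traj (shift T u) (n - u) @^-1` A `&` Y)
  = last_visit u N `&` traj T n @^-1` (A `&` Y).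
Proof.
move=> nN /andP[u0 uN]; have sub : (u + (n - u) = n)%N by clear -nN uN; lia.
have lv x : last_visit u N x <-> Y (traj T u x) /\ avoid Y T u N x.
  by case: u u0 {uN sub}.
have av x : avoid Y (shift T u) 0 (n - u).-1 (traj T u x) <-> avoid Y T u N x.
  split=> av k /andP[k1 k2].
    have ku : (u + (k - u) = k)%N by clear -k1; lia.
    by rewrite -ku -traj_shift; apply: av; clear -k1 k2 nN; lia.
  by rewrite traj_shift; apply: av; clear -k1 k2 nN; lia.
apply/seteqP; split=> x; rewrite /preimage/=/first_return/= traj_shift sub.
  by move=> [[[Yn /av avx] An] Yu]; split=> //; exact/lv.
by move=> [/lv[Yu /av avx] [An Yn]].
Qed.

Lemma exists_at_time n (mu : {measure set X -> \bar R}) :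
  exists kappa : {measure set X -> \bar R},
    forall A, kappa A = mu (traj T n @^-1` (A `&` Y)).
Proof.
unshelve eexists (pushforward (mrestr mu (mpre n mY)) (traj T n) :
  {measure set X -> \bar R}); first exact: measurable_traj.
by [].
Qed.

(** Where the last visit is at time u, nothing is removed after u, so M_N coincides with M_u there.
    For u > 0 that mass has constant K2 at time u, and the first return along the sequence shifted
    by u brings it to K1; for u = 0 the regularity of the initial measure is used. *)
Lemma arrival_LL N : flow N M ->
  LL_le Y m (fun A => M N (traj T N.+1 @^-1` (A `&` Y))) (cK1 c).
Proof.
move=> fl; have [M01 M0reg step] := fl.
(* A finite sum over u <= N, padded with zeros to a series. *)
pose nu_ u A := if (u <= N)%N then
  M u (last_visit u N `&` traj T N.+1 @^-1` (A `&` Y)) else 0.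
pose nu A := M N (traj T N.+1 @^-1` (A `&` Y)).
have nufin : nu setT \is a fin_num.
  by apply: (flow_fin fl) => //; apply: mpre; exact: measurableI.
apply: (@LL_le_series _ _ _ Y m mY m_Y (cdiam c) mdist_le_diam nu nu_ _ (fine (nu setT))) => //.
- by rewrite fineK.
- move=> u; have [uN|uN] := boolP (u <= N)%N; last first.
    by apply: LL_le_zero => // A mA; rewrite /nu_ (negbTE uN).
  suff : LL_le Y m (fun A => M u (last_visit u N
      `&` traj T N.+1 @^-1` (A `&` Y))) (cK1 c).
    by apply: LL_le_ext => A mA; rewrite /nu_ uN.
  case: u uN => [_|u uN].
    have M0fin : M 0%N setT < +oo by rewrite M01 ltry.
    have frLL := LL_le_first_return mY m_Y mT mdist_le_diam (TT_nue S TTT) K1_ge0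
      M0fin M0reg.1 M0reg.2 (ltn0Sn N).
    apply: (LL_le_ext _ frLL) => A mA; congr (M 0%N _).
    by apply/seteqP; split=> x /=; [move=> [[Yx av] Ax]|move=> [[_ av] [Ax Yx]]].
  have [kappa kE] := exists_at_time u.+1 (M u.+1).
  have kLL : LL_le Y m kappa (cK2 c).
    by apply: LL_le_ext (flow_LL (step u uN)) => A mA; rewrite kE.
  have kY : kappa (~` Y) = 0 by rewrite kE setICl preimage_set0 measure0.
  have kfin : kappa setT < +oo.
    rewrite kE (le_lt_trans (flow_le1 fl uN _))// ?ltry//.
    by apply: mpre; exact: measurableI.
  have [kC ka] := LL_le_regular_along (TTshift u.+1) kY kLL.
  have n0 : (0 < N.+1 - u.+1)%N by rewrite subn_gt0.
  have frLL := LL_le_first_return mY m_Y (fun k => mT (u.+1 + k)) mdist_le_diam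
    (TT_nue S (TTshift u.+1)) K1_ge0 kfin kC ka n0.
  apply: (LL_le_ext _ frLL) => A mA.
  by rewrite kE (last_visit_first_return A erefl).
- move=> A mA; rewrite /nu.
  have mB : measurable (traj T N.+1 @^-1` (A `&` Y)) by apply: mpre; exact: measurableI.
  set B := traj T N.+1 @^-1` (A `&` Y) in mB *.
  transitivity (M N (\bigcup_(u in [set u | (u <= N)%N]) (last_visit u N `&` B))).
    congr (M N _); apply/seteqP; split=> [x Bx|x [u _ []]//].
    by have [u uN xu] := last_visit_cover N x; exists u.
  rewrite measure_bigcup; last 2 first.
  + by move=> u _; apply: measurableI => //; exact: measurable_last_visit.
  + move=> u u' uN u'N [x [[xu _] [xu' _]]].
    by apply: (trivIset_last_visit uN u'N); exists x.
  rewrite eseries_mkcond; apply: eq_eseriesr => u _.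
  rewrite /nu_; have [uN|uN] := boolP (u <= N)%N; last first.
    by rewrite memNset//= ; exact/negP.
  rewrite mem_set//=.
  have mDB : measurable (last_visit u N `&` B).
    by apply: measurableI => //; exact: measurable_last_visit.
  apply: (flow_avoid fl _ mDB); first by rewrite uN leqnn.
  by move=> x [[_ av] _].
Qed.

End flow.

(** * A lower bound for the mass arriving in Y *)

Section arrival_mass.
Context d (R : realType) (X : borelMetricType d R).
Variables (c : constants R) (h : nat -> R) (Y : set X) (m : probability X R).
Variables (TT : set (X -> X)) (P : (nat -> X -> X) -> set (set X)).
Hypothesis S : setting c h Y m TT P.
Variable T : nat -> X -> X.
Hypothesis TTT : forall k, TT (T k).
Let mY := Y_measurable S.
Let m_Y := m_Y S.
Let mT k : measurable_fun setT (T k). Proof. exact: (TT_traj S). Qed.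
Let TTshift u k : TT (shift T u k). Proof. exact: TTT. Qed.
Let mpre n A : measurable A -> measurable (traj T n @^-1` A).
Proof. exact: measurable_traj_preimage. Qed.
Let K2_ge0 : (0 <= cK2 c)%R.
Proof. exact/ltW/(lt_trans (K1_gt0 S) (K1_lt_K2 S)). Qed.

Lemma setting_admissible_constants : admissible_constants c.
Proof.
split; [exact: K1_gt0 S|exact: K1_lt_K2 S| |exact: n0_ge1 S|].
  have [x Yx] : Y !=set0.
    apply/set0P/eqP => Y0; have := Defs.m_Y S; rewrite Y0 measure0.
    by move=> /(congr1 fine)/= /esym/eqP; rewrite oner_eq0.
  by rewrite (le_trans (mdist_ge0 x x))// (mdist_le_diam S).
rewrite (delta0_gt0 S)/= -lee_fin.
by rewrite (le_trans (NU7 (TT_nue S TTT) (leqnn _)))// probability_le1//; exact: mpre.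
Qed.

Variables (N L : nat) (M : nat -> {measure set X -> \bar R}) (w r : nat -> R).
Hypothesis fl : flow c Y m P T N M.
Hypothesis Mw : forall j, (j <= N)%N -> M j setT = (w j)%:E.
Hypothesis tailr : forall n, M 0%N (avoid Y T 0 n.-1) <= (r n)%:E.
Hypothesis sumH : forall q, (\sum_(0 <= u < q - L) flight_tail c h (q - u).+1 <= 8^-1)%R.

Let F j A : R := fine (M j A).
Let FE j A : (j <= N)%N -> measurable A -> M j A = (F j A)%:E.
Proof. by move=> jN mA; rewrite fineK// (flow_fin fl). Qed.
Let F0 j A : (0 <= F j A)%R. Proof. by rewrite fine_ge0. Qed.
Let Fle j A B : (j <= N)%N -> measurable A -> measurable B -> A `<=` B ->
  (F j A <= F j B)%R.
Proof. by move=> jN mA mB AB; rewrite -lee_fin -!FE// le_measure ?inE. Qed.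

Let x q := F 0 (avoid Y T 0 q).
Let mav i j : measurable (avoid Y T i j). Proof. exact: measurable_avoid. Qed.

Let visit_mass j : R := F j (traj T j @^-1` Y).

Lemma never_visited_le q : (x q <= running_min r q.+1)%R.
Proof.
have x1 : (x q <= 1)%R by rewrite -lee_fin -FE// (flow_le1 fl).
apply: running_min_ge => // k kq; rewrite -lee_fin -FE//.
apply: le_trans (tailr k); rewrite le_measure ?inE//.
by move=> y av j /andP[j0 jk]; apply: av; clear -j0 jk kq; lia.
Qed.

(** Orbits that avoid Y up to time q have lost nothing by time u and are not in Y then. Subtracting
    them is the origin of the factor 1 - sum of H in [flight_bound]. *)
Lemma visit_mass_le u q : (0 < u <= q)%N -> (q <= N)%N ->
  (visit_mass u <= w u - x q)%R.
Proof.
move=> /andP[u0 uq] qN; have uN := leq_trans uq qN.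
have xu : x q = F u (avoid Y T 0 q).
  rewrite /x /F (flow_avoid fl (i := 0) (j := u)) ?uN// => y av k /andP[k0 ku].
  by apply: av; rewrite k0 (leq_trans ku).
rewrite lerBrDr xu -lee_fin -Mw// EFinD -!FE//; last exact: mpre.
rewrite -measureU//; [|exact: mpre|]; last first.
  by apply/seteqP; split => // y [/= Yy av]; apply: (av u) => //; rewrite u0.
by rewrite le_measure ?inE//; apply: measurableU => //; exact: mpre.
Qed.

Lemma at_time_LL u : (0 < u <= N)%N ->
  LL_le Y m (fun A => M u (traj T u @^-1` (A `&` Y))) (cK2 c).
Proof.
by case: u => // u /= uN; have [_ _ st] := fl; exact: flow_LL (st u uN).
Qed.

Lemma visit_massE u : (0 < u <= N)%N ->
  (fun A => M u (traj T u @^-1` (A `&` Y))) setT = (visit_mass u)%:E.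
Proof. by move=> /andP[_ uN]; rewrite setTI FE//; exact: mpre. Qed.

(** The density in Y at time u is at most [distortion] times its mass, and (NU5) for the sequence
    shifted by u bounds the m-measure of the long flights. *)
Lemma long_flight_mass_le u q : (0 < u <= q)%N -> (q <= N)%N ->
  (F u (last_visit Y T u q) <= (w u - x q) * flight_tail c h (q - u).+1)%R.
Proof.
move=> uq qN; have /andP[u0 u_q] := uq; have uN := leq_trans u_q qN.
have u0N : (0 < u <= N)%N by rewrite u0.
pose B := avoid Y (shift T u) 0 (q - u).
have mB : measurable B by apply: measurable_avoid => // k; exact: mT.
have lvE : last_visit Y T u q = traj T u @^-1` (B `&` Y).
  apply/seteqP; split=> y; rewrite /last_visit /preimage /=.
    move=> [Yu av]; split; last by case: u u0 {uq u_q uN u0N B mB av} Yu.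
    by move=> k /andP[k0 kq]; rewrite traj_shift; apply: av; clear -k0 kq u_q; lia.
  move=> [av Yu]; split; first by case: u u0 {uq u_q uN u0N B mB av} Yu.
  move=> k /andP[uk kq]; have ku : (u + (k - u) = k)%N by clear -uk; lia.
  by rewrite -ku -traj_shift; apply: av; clear -uk kq; lia.
have mlv : measurable (last_visit Y T u q) by exact: (measurable_last_visit S TTT).
rewrite -lee_fin -FE// lvE.
apply: (le_trans (LL_le_upper mY m_Y (mdist_le_diam S) K2_ge0 (visit_massE u0N)
  (at_time_LL u0N) mB)).
have hB : m B <= (h (q - u).+1)%:E.
  apply: le_trans (NU5 (TT_nue S (TTshift u)) (q - u).+1).
  rewrite (_ : [set _ | _] = B)//.
  apply/seteqP; split=> y; first by move=> /tau_ge.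
  by move=> By; apply/tau_ge.
have v0 : (0 <= visit_mass u)%R by exact: F0.
apply: (@le_trans _ _ ((expR (cK2 c * cdiam c) * visit_mass u)%:E * (h (q - u).+1)%:E)).
  by rewrite lee_wpmul2l// lee_fin mulr_ge0// expR_ge0.
rewrite -EFinM lee_fin /flight_tail /distortion mulrA.
rewrite ler_wpM2r ?(h_ge0 S)// mulrC ler_wpM2r ?expR_ge0//.
exact: visit_mass_le.
Qed.

(** The density in Y at time j is at least its mass over [distortion], (NU7) applies to the sequence
    shifted by j, and each removal up to time N costs at most a factor 2. *)
Lemma visited_return_mass_le j : (0 < j <= N)%N -> (j + cn0 c <= N.+1)%N ->
  (visit_mass j * (cdelta0 c / distortion c)
    <= 2 ^+ (N - j) * F N (traj T N.+1 @^-1` Y))%R.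
Proof.
move=> j0N jn; have /andP[j0 jN] := j0N.
pose B := traj (shift T j) (N.+1 - j) @^-1` Y.
have mB : measurable B by apply: measurable_traj_preimage => // k; exact: mT.
have mn : measurable (traj T N.+1 @^-1` Y) by exact: mpre.
have hB : (cdelta0 c)%:E <= m B.
  by apply: (NU7 (TT_nue S (TTshift j))); clear -jn; lia.
have v0 : (0 <= visit_mass j)%R by exact: F0.
have low := LL_le_lower mY m_Y (mdist_le_diam S) K2_ge0 (visit_massE j0N)
  (at_time_LL j0N) mB v0.
rewrite -lee_fin [leRHS]EFinM -FE//.
apply: le_trans (flow_double fl _ mn (i := j)); last by rewrite jN leqnn.
apply: (@le_trans _ _ (M j (traj T j @^-1` (B `&` Y)))); last first.
  rewrite le_measure ?inE//; first by apply: mpre; exact: measurableI.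
  move=> y [By _]; move: By; rewrite /B /preimage /mkset traj_shift subnKC//.
  exact: leqW.
apply: le_trans low.
apply: (@le_trans _ _ ((expR (- (cK2 c * cdiam c)) * visit_mass j)%:E * (cdelta0 c)%:E)).
  rewrite -EFinM lee_fin /distortion -expRN.
  by rewrite le_eqVlt; apply/orP; left; apply/eqP; ring.
by rewrite lee_wpmul2l// lee_fin mulr_ge0 ?expR_ge0.
Qed.

(** Split the mass at time q = N + 1 - n0 by the last visit u. The piece u = 0 is bounded by r,
    those with 1 <= u < q - L by the long flights, and each of the at most L + 1 others by a
    multiple of the mass arriving at N + 1. *)
Lemma arrival_mass_ge :
  (return_rate c L * (w N - flight_bound (flight_tail c h) (running_min r)
     (cn0 c) L w N.+1) <= F N (traj T N.+1 @^-1` Y))%R.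
Proof.
have adm := setting_admissible_constants.
have /andP[rr0 _] := return_rate_gt0 L adm.
set v := F N _; have v0 : (0 <= v)%R by exact: F0.
have wE j : (j <= N)%N -> w j = F j setT by move=> jN; apply/EFin_inj; rewrite -Mw// FE.
have wle i j : (i <= j <= N)%N -> (w j <= w i)%R.
  move=> /andP[ij jN]; rewrite -lee_fin -!Mw//; last exact: leq_trans jN.
  by apply: (flow_homo fl); rewrite ?ij.
have w0 : w 0%N = 1%R by apply/EFin_inj; rewrite -Mw//; have [] := fl.
rewrite /flight_bound; set q := (N.+1 - cn0 c)%N.
set Sg := (\sum_(0 <= u < q - L) flight_tail c h (q - u).+1)%R.
set W := (\sum_(0 <= u < q - L) w u * flight_tail c h (q - u).+1)%R.
have H0 := flight_tail_ge0 c (h_ge0 S).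
have xq := never_visited_le q.
have Sg8 : (Sg <= 8^-1)%R by exact: sumH.
(* For N + 1 <= n0 there is no visit to use; the flight bound is then at least 1, and the left side
   is not positive. *)
have [q0|q0] := posnP q.
  have x1 : x q = 1%R.
    apply/EFin_inj; rewrite /x -FE// q0; have [<- _ _] := fl.
    congr (M 0%N _); apply/seteqP; split => // y _ k /andP[k0]; rewrite leqNgt.
    by rewrite k0.
  have -> : Sg = 0%R by rewrite /Sg q0 big_geq.
  have -> : W = 0%R by rewrite /W q0 big_geq.
  apply: (le_trans _ v0); rewrite pmulr_rle0// subr0 mulr1 addr0 subr_le0.
  by rewrite (le_trans _ xq)// x1 -w0 wle// leqnn.
have qN : (q <= N)%N by have := adm_n0 adm; rewrite /q; clear; lia.
have split_q : (w q <= \sum_(0 <= u < q.+1) F u (last_visit Y T u q))%R.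
  rewrite -lee_fin -Mw// -sumEFin.
  have mlv u : measurable (last_visit Y T u q) by exact: (measurable_last_visit S TTT).
  apply: (@le_trans _ _ (\sum_(0 <= u < q.+1) M q (last_visit Y T u q))).
    rewrite big_mkord; apply: (content_subadditive (M q) (A := setT)
      (F := fun u => last_visit Y T u q)) => // y _.
    have [u uq yu] := last_visit_cover Y T q y.
    by have <- := bigcup_mkord q.+1 (fun u => last_visit Y T u q); exists u.
  rewrite !big_nat; apply: lee_sum => u /andP[_ uq].
  rewrite -FE//; last exact: leq_trans qN.
  rewrite (flow_avoid fl (i := u)) ?leqnn ?qN ?andbT//.
  by move=> y [].
pose p := maxn 1 (q - L).
have p1 : (1 <= p)%N by exact: leq_maxl.
have pq : (p <= q.+1)%N by rewrite geq_max leqW// leqW// leq_subr.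
have A0 : F 0 (last_visit Y T 0 q) = x q by rewrite /last_visit setTI.
have A1 : (\sum_(1 <= u < p) F u (last_visit Y T u q) <= W - x q * Sg)%R.
  apply: (@le_trans _ _ (\sum_(1 <= u < p) (w u - x q) * flight_tail c h (q - u).+1)%R).
    apply: ler_sum_nat => u /andP[u0 up]; apply: long_flight_mass_le => //.
    by rewrite u0 -ltnS (leq_trans up pq).
  rewrite /W /Sg mulr_sumr -sumrB.
  under [leRHS]eq_bigr do rewrite -mulrBl.
  rewrite /p; have [->|qL] := posnP (q - L); first by rewrite !big_geq.
  rewrite (maxn_idPr qL) [leRHS]big_ltn// lerDr mulr_ge0// subr_ge0 w0.
  by rewrite -lee_fin /x -FE// (flow_le1 fl).
(* A visit in [q - L, q] is at most n0 + L steps before time N + 1. *)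
pose g := (2 ^+ (cn0 c + L) * distortion c / cdelta0 c)%R.
have /andP[de0 _] := adm_delta0 adm.
have di0 : (0 < distortion c)%R by exact: expR_gt0.
have g0 : (0 < g)%R by rewrite divr_gt0// mulr_gt0// exprn_gt0.
have A2 u : (p <= u < q.+1)%N -> (F u (last_visit Y T u q) <= g * v)%R.
  move=> /andP[pu uq]; have u0 : (0 < u)%N by exact: leq_trans pu.
  have uN : (u <= N)%N by exact: leq_trans qN.
  apply: (@le_trans _ _ (visit_mass u)).
    apply: Fle => //; first exact: (measurable_last_visit S TTT).
      exact: mpre.
    by move=> y [+ _]; case: u u0 {pu uq uN}.
  have := visited_return_mass_le (j := u); rewrite u0 uN => /(_ isT) vr.
  have {}vr : (visit_mass u * (cdelta0 c / distortion c)
      <= 2 ^+ (cn0 c + L) * v)%R.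
    apply: (le_trans (vr _)); first by rewrite /q in uq; clear -uq q0; lia.
    rewrite ler_wpM2r// ler_weXn2l ?ler1n//.
    have := leq_trans (leq_maxr 1 (q - L)) pu.
    by rewrite /q; clear; lia.
  rewrite -(ler_pM2r (divr_gt0 de0 di0)) (le_trans vr)//.
  rewrite le_eqVlt; apply/orP; left; apply/eqP; rewrite /g; field.
  by rewrite !gt_eqF.
have A3 : (\sum_(p <= u < q.+1) F u (last_visit Y T u q) <= L.+1%:R * (g * v))%R.
  apply: (@le_trans _ _ (\sum_(p <= u < q.+1) g * v)%R); first exact: ler_sum_nat.
  have gv0 : (0 <= g * v)%R by apply: mulr_ge0 => //; exact: ltW.
  rewrite sumr_const_nat -[leLHS]mulr_natl ler_wpM2r// ler_nat.
  by have := leq_maxr 1 (q - L); rewrite -/p; clear; lia.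
move: split_q; rewrite big_ltn// A0 (@big_cat_nat _ _ _ p)//= => split_q.
have wNq : (w N <= w q)%R by rewrite wle// qN leqnn.
have Sg1 : (x q * (1 - Sg) <= running_min r q.+1 * (1 - Sg))%R.
  by rewrite ler_wpM2r// subr_ge0 (le_trans Sg8)// invf_le1// ler1n.
have main : (w N - (running_min r q.+1 * (1 - Sg) + W) <= L.+1%:R * (g * v))%R.
  by move: A1 A3 split_q wNq Sg1; lra.
have -> : return_rate c L = ((L.+1%:R * g)^-1)%R.
  rewrite /return_rate /g exprVn; field.
  by rewrite !gt_eqF// ?exprn_gt0// ltr0n.
have Lg : (0 < L.+1%:R * g)%R by rewrite mulr_gt0// ltr0n.
by rewrite ler_pdivrMl// -mulrA.
Qed.

End arrival_mass.

(** * The decomposition *)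

(** Dependent choice in which the existence of a next value may rely on all steps made so far, as
    the arrival bounds do. Where no next value exists, g repeats the last one. *)
Lemma exists_history_sequence (A : Type) (x0 : A) (step : nat -> A -> A -> Prop) :
  (forall n (f : nat -> A), f 0%N = x0 ->
    (forall j, (j < n)%N -> step j (f j) (f j.+1)) -> exists y, step n (f n) y) ->
  exists f : nat -> A, f 0%N = x0 /\ forall n, step n (f n) (f n.+1).
Proof.
move=> next; pose g := fix g n := if n is k.+1 then
  (if pselect (exists y, step k (g k) y) is left e then sval (cid e) else g k)
  else x0.
exists g; split => //; elim/ltn_ind => n IH.
have ex := next n g erefl IH.
rewrite [g n.+1]/=; case: pselect => // e.
by case: cid.
Qed.

Lemma exists_normalized d (X : measurableType d) (R : realType)
    (nu : {measure set X -> \bar R}) (a : R) : (0 < a)%R -> nu setT = a%:E ->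
  exists p : probability X R, forall A, nu A = a%:E * p A.
Proof.
move=> a0 nua; have ia0 : (0 <= a^-1)%R by rewrite invr_ge0 ltW.
pose p0 : {measure set X -> \bar R} := mscale (NngNum ia0) nu.
have p1 : p0 setT = 1 
    by rewrite -[LHS]/((a^-1)%:E * nu setT) nua -EFinM mulVf// gt_eqF.
pose p : probability X R := HB.pack (Measure.sort p0)
  (Measure_isProbability.Build _ _ _ p0 p1).
exists p => A; rewrite -[p A]/((a^-1)%:E * nu A) muleA -EFinM mulfV ?mul1e//.
by rewrite gt_eqF.
Qed.

Section construction.
Context d (R : realType) (X : borelMetricType d R).
Variables (c : constants R) (h r : nat -> R) (Y : set X) (m : probability X R).
Variables (TT : set (X -> X)) (P : (nat -> X -> X) -> set (set X)).
Hypothesis S : setting c h Y m TT P.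
Variable T : nat -> X -> X.
Hypothesis TTT : forall k, TT (T k).
Let mY := Y_measurable S.
Let m_Y := m_Y S.
Let mT k : measurable_fun setT (T k). Proof. exact: (TT_traj S). Qed.
Let mpre n A : measurable A -> measurable (traj T n @^-1` A).
Proof. exact: measurable_traj_preimage. Qed.
Let admc := setting_admissible_constants S TTT.

Lemma exists_flow_step n (M : {measure set X -> \bar R}) (v a : R) :
  M (traj T n @^-1` Y) = v%:E ->
  LL_le Y m (fun A => M (traj T n @^-1` (A `&` Y))) (cK1 c) ->
  (0 <= a <= extractable c * v)%R ->
  exists M' E : {measure set X -> \bar R}, [/\ flow_step c Y m T n M M',
    (forall A, measurable A -> M A = M' A + E A)
    & (forall A, measurable A -> E (traj T n @^-1` A) = a%:E * m A)].
Proof.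
move=> Mv MLL av.
have [M' [E [ME Mhalf E0 Ea M'LL]]] := exists_extraction mY m_Y (mdist_le_diam S)
  (measurable_traj n mT) (K1_gt0 S) (K1_lt_K2 S) Mv MLL av.
exists M', E; split => //; split => // A mA; first by rewrite ME// leeDl.
move=> AY; rewrite ME// (_ : E A = 0) ?adde0//.
apply/eqP; rewrite -measure_le0 -[leRHS]E0 le_measure ?inE//.
by apply: measurableC; exact: mpre.
Qed.

(* mu_n is required to exist even if alpha_n = 0.  By (NU7), m started n0 steps
   before time 0 has positive mass in Y at time n. *)
Lemma exists_preimage_law n : exists p : probability X R,
  forall A, measurable A -> p (traj T n @^-1` A) = m A.
Proof.
(* The map T_1 is put n0 more times in front of the sequence. *)
pose T' k := if (k < cn0 c)%N then T 0%N else T (k - cn0 c)%N.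
have TTT' k : TT (T' k) by rewrite /T'; case: ifP => _; exact: TTT.
have T'T : shift T' (cn0 c) = T.
  by apply/funext => k; rewrite /shift /T' ltnNge leq_addr/= addKn.
have mT' k : measurable_fun setT (T' k) by exact: (TT_traj S).
(* The flow from which nothing is ever removed, so that [arrival_LL] speaks of m itself. *)
pose M (k : nat) : {measure set X -> \bar R} := m.
have mLL : LL_le Y m m (cK2 c).
  have K2 : (0 <= cK2 c)%R by exact/ltW/(lt_trans (K1_gt0 S) (K1_lt_K2 S)).
  apply/(LL_leP Y m m K2); exists (cst 1%R).
    by split => // A mA; have := integral_cst m mA 1%:E; rewrite mul1e => <-.
  by move=> y y' _ _; rewrite mul1r -expR0 ler_expR mulr_ge0// mdist_ge0.
have mYC : m (~` Y) = 0 by rewrite probability_setC// m_Y subee.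
have fl N : flow c Y m P T' N M.
  elim: N => [|N [M0 Mreg IH]].
    by split => //; [exact: probability_setT|exact: (LL_le_regular_along S TTT')].
  split => // k; rewrite ltnS leq_eqVlt => /predU1P[->|]; last exact: IH.
  split => // [A mA|].
    by rewrite -[leLHS]mul1e lee_wpmul2r// lee_fin ler1n.
  apply: LL_le_trans (arrival_LL S TTT' (And3 M0 Mreg IH)).
  exact/ltW/(K1_lt_K2 S).
have [kappa kE] : exists kappa : {measure set X -> \bar R},
    forall A, kappa A = m (traj T' (cn0 c) @^-1` A).
  unshelve eexists (pushforward m (traj T' (cn0 c)) : {measure set X -> \bar R}).
    exact: measurable_traj.
  by [].
have trajE A : traj T' (cn0 c) @^-1` (traj T n @^-1` A) = traj T' (cn0 c + n) @^-1` A.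
  by apply/seteqP; split => x; rewrite /preimage /mkset -T'T traj_shift.
have n1 : (cn0 c + n = (cn0 c + n).-1.+1)%N.
  by rewrite prednK// addn_gt0 (adm_n0 admc).
pose v := fine (m (traj T' (cn0 c + n) @^-1` Y)).
have mv : m (traj T' (cn0 c + n) @^-1` Y) = v%:E.
  by rewrite /v fineK// fin_num_measure//; exact: measurable_traj_preimage.
have v0 : (0 < v)%R.
  rewrite (lt_le_trans (delta0_gt0 S))// -lee_fin -mv.
  by apply: (NU7 (TT_nue S TTT')); exact: leq_addr.
have /andP[ex0 _] := extractable_gt0 admc.
have kv : kappa (traj T n @^-1` Y) = v%:E by rewrite kE trajE.
have kLL : LL_le Y m (fun A => kappa (traj T n @^-1` (A `&` Y))) (cK1 c).
  apply: LL_le_ext (arrival_LL S TTT' (fl (cn0 c + n).-1)) => A mA.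
  by rewrite kE trajE -n1.
have a0 : (0 < extractable c * v)%R by exact: mulr_gt0.
have aa : (0 <= extractable c * v <= extractable c * v)%R by rewrite lexx ltW.
have [M' [E [_ _ Ea]]] := exists_flow_step kv kLL aa.
have ET : E setT = (extractable c * v)%:E.
  by have := Ea _ measurableT; rewrite preimage_setT probability_setT mule1.
have [p Ep] := exists_normalized a0 ET.
exists p => A mA; have := Ea A mA; rewrite Ep.
move=> /(congr1 (fun z => ((extractable c * v)^-1)%:E * z)).
by rewrite !muleA -EFinM mulVf ?mul1e// gt_eqF.
Qed.

Variable mu : probability X R.
Hypothesis r0 : forall n, (0 <= r n)%R.
Hypothesis r_small : forall e : R, (0 < e)%R -> exists n, (r n < e)%R.
Hypothesis mu_reg : regular c Y m TT P mu.
Hypothesis mu_tail : tail_bound Y TT mu r.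

Let tail n : mu (avoid Y T 0 n.-1) <= (r n)%:E.
Proof.
have -> : avoid Y T 0 n.-1 =
    [set x | forall k, (1 <= k < n)%N -> ~ Y (traj T k x)].
  apply/seteqP; split=> x av k /andP[k0 kn]; apply: av; rewrite k0.
    by clear -k0 kn; lia.
  by clear -k0 kn; lia.
exact: mu_tail.
Qed.

Lemma setting_admissible_tails : admissible_tails c h r.
Proof.
split => //; first exact: h_ge0 S.
- move=> M; rewrite -lee_fin -sumEFin; apply: le_trans (NU6 (TT_nue S TTT)).
  by apply: nneseries_lim_ge => k _ _; rewrite lee_fin (h_ge0 S).
- have av0 : avoid Y T 0 0 = setT.
    by apply/seteqP; split=> // x _ k /andP[k0]; rewrite leqNgt k0.
  by split; rewrite -lee_fin; have := tail 0; have := tail 1; rewrite /= av0 probability_setT.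
Qed.
Let adm := setting_admissible_tails.

Lemma exists_decomposition : exists mu_ : nat -> probability X R,
  (forall A, measurable A ->
    mu A = \sum_(1 <= n <oo) (alpha c h r n)%:E * mu_ n A) /\
  (forall n, (1 <= n)%N -> forall A, measurable A ->
    pushforward (mu_ n) (traj T n) A = m A).
Proof.
pose w := left_mass c h r.
pose step n (M M' : {measure set X -> \bar R}) := flow_step c Y m T n.+1 M M' /\
  exists E : {measure set X -> \bar R},
    (forall A, measurable A -> M A = M' A + E A) /\
    (forall A, measurable A -> E (traj T n.+1 @^-1` A) = (alpha c h r n.+1)%:E * m A).
have mass_step n M M' : step n M M' -> M setT = (w n)%:E -> M' setT = (w n.+1)%:E.
  move=> [_ [E [ME Ea]]] Mw; have := ME _ measurableT.
  have := Ea _ measurableT; rewrite preimage_setT probability_setT mule1 => ->.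
  rewrite Mw => h1; have M'fin : M' setT \is a fin_num.
    rewrite ge0_fin_numE// (@le_lt_trans _ _ (w n)%:E) ?ltry// h1 leeDl// lee_fin.
    exact: (alpha_ge0 h r admc).
  move: h1; rewrite -(fineK M'fin) -EFinD => -[e]; congr EFin; move: e.
  by rewrite /alpha /= /w => e; lra.
have [M [M0 Mstep]] : exists f : nat -> {measure set X -> \bar R},
    f 0%N = mu /\ forall n, step n (f n) (f n.+1).
  apply: exists_history_sequence => n M M0 Mstep.
  have fl : flow c Y m P T n M.
    split; first by rewrite M0; exact: probability_setT.
      by rewrite M0; exact: mu_reg.
    by move=> j /Mstep[].
  have Mw j : (j <= n)%N -> M j setT = (w j)%:E.
    elim: j => [_|j IH jn]; first by rewrite M0; exact: probability_setT.
    exact: mass_step (Mstep j jn) (IH (ltnW jn)).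
  have HL := short_flights_sum (adm_h0 adm) (short_flights_lag adm).
  have tailM k : M 0%N (avoid Y T 0 k.-1) <= (r k)%:E by rewrite M0; exact: tail.
  have := arrival_mass_ge S TTT fl Mw tailM HL; set v := fine _ => vge.
  have Mv : M n (traj T n.+1 @^-1` Y) = v%:E.
    by rewrite /v fineK// (flow_fin fl)//; exact: mpre.
  have v0 : (0 <= v)%R by rewrite fine_ge0.
  have /andP[ex0 _] := extractable_gt0 admc.
  (* If the flight bound exceeds w_n then alpha is 0; otherwise the bound for the arriving mass is
     used. *)
  have av : (0 <= alpha c h r n.+1 <= extractable c * v)%R.
    rewrite (alpha_ge0 h r admc)/= alphaS /rate -mulrA ler_wpM2l ?(ltW ex0)//.
    rewrite -/w; move: vge; set z := (w n - _)%R => vge.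
    by have [_|_] := leP 0%R z; [exact: vge|rewrite mulr0].
  have [M' [E [st ME Ea]]] := exists_flow_step Mv (arrival_LL S TTT fl) av.
  by exists M'; split => //; exists E.
have Mw n : M n setT = (w n)%:E.
  elim: n => [|n IH]; first by rewrite M0; exact: probability_setT.
  exact: mass_step (Mstep n) IH.
have /choice[E HE] : forall n, exists E : {measure set X -> \bar R},
    (forall A, measurable A -> M n A = M n.+1 A + E A) /\
    (forall A, measurable A -> E (traj T n.+1 @^-1` A) = (alpha c h r n.+1)%:E * m A).
  by move=> n; have [] := Mstep n.
have ET n : E n setT = (alpha c h r n.+1)%:E.
  by have := (HE n).2 _ measurableT; rewrite preimage_setT probability_setT mule1.
have /choice[mu_ Hmu_] : forall n, exists p : probability X R, (1 <= n)%N ->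
    (forall A, measurable A -> E n.-1 A = (alpha c h r n)%:E * p A) /\
    (forall A, measurable A -> p (traj T n @^-1` A) = m A).
  (* Index 0 is outside the sum, so any probability measure will do. *)
  case=> [|n]; first by exists mu.
  have := alpha_ge0 h r admc n.+1; rewrite le_eqVlt => /predU1P[a0|a0].
    have [p pE] := exists_preimage_law n.+1; exists p => _; split => // A mA.
    rewrite -a0 mul0e; apply/eqP; rewrite -measure_le0.
    by rewrite (@le_trans _ _ (E n setT)) ?le_measure ?inE// ET -a0.
  have [p pE] := exists_normalized a0 (ET n); exists p => _; split => // A mA.
  have := (HE n).2 A mA; rewrite pE.
  move=> /(congr1 (fun z => ((alpha c h r n.+1)^-1)%:E * z)).
  by rewrite !muleA -EFinM mulVf ?mul1e// gt_eqF.
exists mu_; split=> [A mA|n n1 A mA]; last exact: (Hmu_ n n1).2.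
have partial n : mu A = \sum_(1 <= j < n.+1) (alpha c h r j)%:E * mu_ j A + M n A.
  elim: n => [|n IH]; first by rewrite big_geq// add0e M0.
  rewrite big_nat_recr//= -(Hmu_ n.+1 isT).1//= IH -addeA (HE n).1//.
  by rewrite [M n.+1 A + _]addeC.
(* The remainder of every set is at most w_n, so the partial decompositions exhaust mu. *)
have MA0 : M n A @[n --> \oo] --> (0 : \bar R).
  apply: (@squeeze_cvge _ _ _ _ (cst 0) _ (fun n => (w n)%:E)).
  - by apply: nearW => n; rewrite measure_ge0/= -Mw le_measure ?inE.
  - exact: cvg_cst.
  - apply: cvg_EFin; first exact: nearW.
    exact: (left_mass_cvg0 admc adm).
apply/esym/cvg_lim => //.
have Mfin n : M n A \is a fin_num.
  rewrite ge0_fin_numE// (@le_lt_trans _ _ (M n setT)) ?le_measure ?inE//.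
  by rewrite Mw ltry.
rewrite -(cvg_shiftn 1); have -> : (fun n => \sum_(1 <= j < n + 1)
    (alpha c h r j)%:E * mu_ j A) = (fun n => mu A - M n A).
  by apply/funext => n; rewrite addn1 (partial n) addeK.
have : (mu A - M n A) @[n --> \oo] --> (mu A - 0 : \bar R).
  apply: cvgeB; [|exact: cvg_cst|exact: MA0].
  by apply: fin_num_adde_defl; rewrite fin_numN.
by rewrite sube0.
Qed.

End construction.

Unset Implicit Arguments.
Set Strict Implicit.

(* alpha, C1, C2, C3, C3' are chosen before the system, so they depend only on
   their arguments.  The hypothesis inf r = 0 is implicit in the notion of a
   tail bound: without it a fixed alpha of total mass 1 cannot exist.  It
   follows from the assumptions on r in (1) and in (3). *)
Theorem theorem3p8 (R : realType) :
  exists (alpha : constants R -> (nat -> R) -> (nat -> R) -> nat -> R)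
    (C1 : constants R -> R -> R -> R -> R)
    (C2 : constants R -> R -> R -> R)
    (C3 C3' : constants R -> R -> R -> R -> R),
  forall (c : constants R) (h r : nat -> R)
    (d : measure_display) (X : borelMetricType d R) (Y : set X)
    (m : probability X R) (TT : set (X -> X))
    (P : (nat -> X -> X) -> set (set X)) (mu : probability X R),
  setting c h Y m TT P ->
  (forall n, (0 <= r n)%R) ->
  (forall e : R, (0 < e)%R -> exists n, (r n < e)%R) ->
  regular c Y m TT P mu ->
  tail_bound Y TT mu r ->
  forall T : nat -> X -> X, (forall k, TT (T k)) ->
  [/\ (forall n, (1 <= n)%N -> (0 <= alpha c h r n)%R),
      \sum_(1 <= n <oo) (alpha c h r n)%:E = 1,
      (exists mu_ : nat -> probability X R,
        (forall A, measurable A ->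
          mu A = \sum_(1 <= n <oo) (alpha c h r n)%:E * mu_ n A) /\
        (forall n, (1 <= n)%N -> forall A, measurable A ->
          pushforward (mu_ n) (traj T n) A = m A))
    & [/\
      (* (1) *)
      (forall Cb Cb' b b' : R, (1 < b)%R -> (0 < b')%R -> (b' <= b)%R ->
        (forall n, (1 <= n)%N -> (h n <= Cb * n%:R `^ (- b))%R) ->
        (forall n, (1 <= n)%N -> (r n <= Cb' * n%:R `^ (- b'))%R) ->
        forall n, (1 <= n)%N ->
        \sum_(n <= j <oo) (alpha c h r j)%:E
          <= (C1 c Cb b b' * Cb' * n%:R `^ (- b'))%:E),
      (* (2) *)
      (forall Cb b : R, (1 < b)%R ->
        (forall n, (1 <= n)%N -> (h n <= Cb * n%:R `^ (- b))%R) ->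
        forall n, (2 * cn0 c <= n)%N ->
        \sum_(n <= j <oo) (alpha c h r j)%:E
          <= (r (n./2 - cn0 c)%N)%:E
             + (C2 c Cb b * n%:R `^ (- b))%:E * \sum_(1 <= j <oo) (r j)%:E)
    & (* (3) *)
      (forall Cb Cb' b : R, (0 < b)%R -> (b <= 1)%R ->
        (0 < Cb)%R -> (0 < Cb')%R ->
        (forall n, (h n <= Cb * expR (- (Cb' * n%:R `^ b)))%R) ->
        (forall n, (r n <= Cb * expR (- (Cb' * n%:R `^ b)))%R) ->
        [/\ (0 < C3 c Cb Cb' b)%R, (0 < C3' c Cb Cb' b)%R
          & forall n, (1 <= n)%N ->
            \sum_(n <= j <oo) (alpha c h r j)%:E
              <= (C3 c Cb Cb' b * expR (- (C3' c Cb Cb' b * n%:R `^ b)))%:E])]].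
Proof.
(* Each constant is chosen as a function of its parameters alone, before h and r; for inadmissible
   parameters it is 0 and nothing is claimed. *)
have /choice[C1 HC1] : forall z : constants R * R * R * R, exists C,
    let: (c, Cb, b, b') := z in admissible_constants c ->
    ((1 < b)%R /\ (0 < b')%R /\ (b' <= b)%R) ->
    forall h r Cb', admissible_tails c h r ->
    (forall n, (1 <= n)%N -> (h n <= Cb * n%:R `^ (- b))%R) ->
    (forall n, (1 <= n)%N -> (r n <= Cb' * n%:R `^ (- b'))%R) ->
    forall n, (1 <= n)%N ->
      (left_mass c h r n.-1 <= C * Cb' * n%:R `^ (- b'))%R.
  move=> [[[c Cb] b] b'].
  have [[adm [b1 [b'0 b'b]]]|no] := pselect (admissible_constants c /\
    ((1 < b)%R /\ (0 < b')%R /\ (b' <= b)%R)); last first.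
    by exists 0%R => adm bb; case: no.
  have [C HC] := left_mass_tail1 Cb adm b1 b'0 b'b.
  by exists C => _ _; exact: HC.
have /choice[C2 HC2] : forall z : constants R * R * R, exists C,
    let: (c, Cb, b) := z in admissible_constants c -> (1 < b)%R ->
    forall h r, admissible_tails c h r ->
    (forall n, (1 <= n)%N -> (h n <= Cb * n%:R `^ (- b))%R) ->
    forall n, (2 * cn0 c <= n)%N ->
      (left_mass c h r n.-1)%:E <= (r (n./2 - cn0 c)%N)%:E
        + (C * n%:R `^ (- b))%:E * \sum_(1 <= j <oo) (r j)%:E.
  move=> [[c Cb] b].
  have [[adm b1]|no] := pselect (admissible_constants c /\ (1 < b)%R); last first.
    by exists 0%R => adm bb; case: no.
  have [C HC] := left_mass_tail2 Cb adm b1.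
  by exists C => _ _; exact: HC.
have /choice[C3 HC3] : forall z : constants R * R * R * R, exists C : R * R,
    let: (c, Cb, Cb', b) := z in admissible_constants c ->
    ((0 < b <= 1)%R /\ (0 < Cb)%R /\ (0 < Cb')%R) ->
    [/\ (0 < C.1)%R, (0 < C.2)%R & forall h r, admissible_tails c h r ->
      (forall n, (h n <= Cb * expR (- (Cb' * n%:R `^ b)))%R) ->
      (forall n, (r n <= Cb * expR (- (Cb' * n%:R `^ b)))%R) ->
      forall n, (1 <= n)%N ->
        (left_mass c h r n.-1 <= C.1 * expR (- (C.2 * n%:R `^ b)))%R].
  move=> [[[c Cb] Cb'] b].
  have [[adm [b01 [Cb0 Cb'0]]]|no] := pselect (admissible_constants c /\
    ((0 < b <= 1)%R /\ (0 < Cb)%R /\ (0 < Cb')%R)); last first.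
    by exists (0%R, 0%R) => adm bb; case: no.
  have [C [C' HC]] := left_mass_tail3 adm b01 Cb0 Cb'0.
  by exists (C, C').
exists (@alpha R), (fun c Cb b b' => C1 (c, Cb, b, b')),
  (fun c Cb b => C2 (c, Cb, b)),
  (fun c Cb Cb' b => (C3 (c, Cb, Cb', b)).1),
  (fun c Cb Cb' b => (C3 (c, Cb, Cb', b)).2).
move=> c h r d X Y m TT P mu S r0 r_small mu_reg mu_tail T TTT.
have admc := setting_admissible_constants S TTT.
have adm := setting_admissible_tails S TTT r0 r_small mu_tail.
split.
- by move=> n _; exact: alpha_ge0.
- by rewrite (series_alpha admc adm (leqnn 1)).
- exact: (exists_decomposition S TTT r0 r_small mu_reg mu_tail).
split.
- move=> Cb Cb' b b' b1 b'0 b'b hCb rCb n n1; rewrite (series_alpha admc adm n1) lee_fin.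
  exact: (HC1 (c, Cb, b, b')).
- move=> Cb b b1 hCb n n2.
  have n1 : (1 <= n)%N by rewrite (leq_trans _ n2)// muln_gt0 (adm_n0 admc).
  rewrite (series_alpha admc adm n1); exact: (HC2 (c, Cb, b)).
- move=> Cb Cb' b b0 b1 Cb0 Cb'0 hCb rCb.
  have b01 : (0 < b <= 1)%R by rewrite b0.
  have [C0 C'0 HC] := HC3 (c, Cb, Cb', b) admc (conj b01 (conj Cb0 Cb'0)).
  split => // n n1; rewrite (series_alpha admc adm n1) lee_fin.
  exact: HC.
Qed.
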